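(* Let $d,N\ge 1$ be integers, let $H$ be a Hilbert space, and let $K:\Lambda_N\times\Lambda_N\to L(H)$ be a positive definite kernel satisfying $K_\Sigma\le K$ on $\Lambda_{N-1}\times\Lambda_{N-1}$. Then there exists a positive definite kernel $\widetilde K:\mathbb{F}^+_d\times\mathbb{F}^+_d\to L(H)$ such that (E1) $\widetilde K(\alpha,\beta)=K(\alpha,\beta)$ for all $\alpha,\beta\in\Lambda_{N-1}$; (E2) $\widetilde K_\Sigma\le\widetilde K$ on $\mathbb{F}^+_d\times\mathbb{F}^+_d$. In particular, $\widetilde K$ satisfying (E1) and (E2) can be chosen to have the form $$\widetilde K(\alpha,\beta)=W^*S^{\alpha}P(S^{\beta})^*W,\qquad \alpha,\beta\in\mathbb{F}^+_d,$$ where $S=(S_1,\dots,S_d)$ is a row isometry with orthogonal ranges on a Hilbert space $\mathcal K$, $P$ is an orthogonal projection on $\mathcal K$, and $W:H\to\mathcal K$ is a bounded linear operator.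
   Context: $\mathbb{F}^+_d$ is the free semigroup (with neutral element, the empty word $\emptyset$) on the letters $\{1,\dots,d\}$; for $\alpha=i_1\cdots i_k$ the length is $|\alpha|=k$, and $\alpha i=i_1\cdots i_k i$ denotes concatenation. For an integer $m\ge 0$, $\Lambda_m=\{\alpha\in\mathbb{F}^+_d:|\alpha|\le m\}$. $L(H)$ is the space of bounded linear operators on $H$. For $E\subset\mathbb{F}^+_d$, a kernel $K:E\times E\to L(H)$ is positive definite (on $E$) if $\sum_{j,k=1}^m\langle u_j,K(\alpha_j,\alpha_k)u_k\rangle_H\ge 0$ for every finite family $(\alpha_j,u_j)_{j=1}^m$ in $E\times H$. The shifted kernel is $K_\Sigma(\alpha,\beta)=\sum_{i=1}^d K(\alpha i,\beta i)$, defined whenever $\alpha i,\beta i\in E$ for all $i$. For $F\subset E$ on which both kernels are defined, $K_\Sigma\le K$ on $F$ (equivalently on $F\times F$) means that $K-K_\Sigma$ is positive definite on $F$. A row isometry with orthogonal ranges on $\mathcal K$ is a tuple $S=(S_1,\dots,S_d)$ of bounded operators on $\mathcal K$ with $S_i^*S_j=\delta_{ij}I_{\mathcal K}$. For $\alpha=i_1\cdots i_k$, $S^\alpha=S_{i_1}\cdots S_{i_k}$, and $S^\emptyset=I_{\mathcal K}$. *)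

(* Defs.v *)
From HB Require Import structures.
From mathcomp Require Import all_boot all_order all_algebra.
From mathcomp Require Import complex.
From mathcomp Require Import boolp classical_sets functions reals.
From mathcomp Require Import topology normedtype.

Set Implicit Arguments.
Unset Strict Implicit.
Unset Printing Implicit Defensive.

Import Order.TTheory GRing.Theory Num.Theory.
Import numFieldNormedType.Exports.

Local Open Scope classical_set_scope.
Local Open Scope ring_scope.

(* Complex Hilbert spaces. As for every [{dot _ for _}], the inner product is
   linear in its first argument and conjugate-linear in the second. *)
HB.mixin Record NormedModule_hasInner (R : realType) H
    & NormedModule R[i] H := {
  inner : {dot H for (@Num.conj R[i])} ;
  inner_norm : forall u : H, inner u u = `|u| ^+ 2
}.

#[short(type="hilbertType")]
HB.structure Definition Hilbert (R : realType) :=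
  {H of CompleteNormedModule R[i] H & NormedModule_hasInner R H}.

Notation "''[' u , v ]" := (inner u v) : ring_scope.

Section Operators.
Context {R : realType}.
Implicit Types G H : hilbertType R.

(* For linear maps between normed spaces, continuity is boundedness; see
   [linear_bounded_continuous]. *)
Definition bounded_operator G H (A : G -> H) : Prop :=
  linear A /\ continuous A.

(* The vector z is unique when it exists, and it exists for every y when A is
   a bounded operator (Riesz); otherwise the value is unspecified. *)
Definition adjoint G H (A : G -> H) : H -> G :=
  fun y => get [set z | forall x, '[A x, y] = '[x, z]].

Lemma adjointP G H (A : G -> H) (B : H -> G) :
  (forall x y, '[A x, y] = '[x, B y]) -> adjoint A = B.
Proof.
move=> AB; apply/funext => y.
have Az : [set z | forall x, '[A x, y] = '[x, z]] (adjoint A y).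
  by apply: getPex; exists (B y) => x; exact: AB.
have A0 x : '[x, adjoint A y - B y] = 0.
  by rewrite linearBr /= -(Az x) AB subrr.
by apply/eqP; rewrite -subr_eq0 -normr_eq0 -sqrf_eq0 -inner_norm A0.
Qed.

Definition orthogonal_projection H (P : H -> H) : Prop :=
  [/\ bounded_operator P, P \o P = P & adjoint P = P].

End Operators.

(* The free semigroup on d letters, with neutral element [::]; the letters are
   numbered from 0 and the word alpha i is [rcons alpha i]. *)
Notation word d := (seq 'I_d).

Definition Lambda (d m : nat) : set (word d) := [set a | (size a <= m)%N].

Arguments Lambda : clear implicits.

Section Kernels.
Context {R : realType} {d : nat}.
Implicit Types (H : hilbertType R) (E : set (word d)).

(* A kernel on E * E is represented by a total function, of which only the
   values on E * E matter. *)
Definition kernel H := word d -> word d -> H -> H.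

Definition operator_valued H E (K : kernel H) : Prop :=
  forall a b, E a -> E b -> bounded_operator (K a b).

Definition positive_definite H E (K : kernel H) : Prop :=
  forall (m : nat) (a : 'I_m -> word d) (u : 'I_m -> H),
    (forall j, E (a j)) ->
    0 <= \sum_(j < m) \sum_(k < m) '[u j, K (a j) (a k) (u k)].

Definition shifted H (K : kernel H) : kernel H :=
  fun a b u => \sum_(i < d) K (rcons a i) (rcons b i) u.

Definition kernel_le H E (K1 K2 : kernel H) : Prop :=
  positive_definite E (fun a b u => K2 a b u - K1 a b u).

Definition row_isometry H (S : 'I_d -> H -> H) : Prop :=
  (forall i, bounded_operator (S i)) /\
  (forall i j x, adjoint (S i) (S j x) = (i == j)%:R *: x).

(* S^(i1 ... ik) = S i1 \o ... \o S ik *)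
Definition word_op H (S : 'I_d -> H -> H) (a : word d) : H -> H :=
  foldr (fun i T => S i \o T) id a.

End Kernels.

Arguments kernel {R} d H.

(* Main.v *)
Require Import Defs.
From HB Require Import structures.
From mathcomp Require Import all_boot all_order all_algebra.
From mathcomp Require Import complex.
From mathcomp Require Import boolp classical_sets functions reals.
From mathcomp Require Import topology normedtype.
From mathcomp Require Import sequences ring.

(** The extension is [a, b |-> W^* S^a (S^b)^* W], with the identity as the
    projection.  Such a kernel is positive definite, and its difference with
    its shift is the Gram kernel of [1 - \sum_i S_i S_i^*], which is positive
    by Bessel's inequality ([row_isometry_bessel]).  So all that is needed is a
    row isometry [S] and an operator [W] such that the vectors [(S^a)^* W u],
    for words [a] of length less than [N], have the inner products prescribed
    by [K].

    Factor [K] as [<u, K(a,b) v> = <V_a u, V_b v>] over the words of length less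
    than [N], in a Hilbert space [G], the closed span of these vectors.  The
    inequality between [K] and its shift says that [V_a u |-> (V_(a i) u)_i] is
    contractive.  When [a] has length [N - 1] the words [a i] have length [N];
    their vectors are compressed to [G], and the kernel on the words of length
    [N] serves to define this compression.  The result ([finite_model]) is a
    family of operators [L_i] on [G] with [\sum_i L_i^* L_i <= 1] and
    [L_i V_a = V_(a i)] for shorter [a].

    Any such family is the restriction to [G] of the adjoints [S_i^*] of a row
    isometry on a larger space ([isometric_dilation]).  This space is built
    from the functions [F] on words, with values in [G], such that
    [F (a i) = L_i (F a)] for all long words [a].  There [S_i^*] sends [F] to
    [a |-> F (i a)], and [S_i] grafts [F] on the letter [i].  An element [g] of
    [G] is represented by the function that maps [i1 ... ik] to
    [L_ik (... (L_i1 g))], so that [S_i^*] acts on it as [L_i], and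
    [(S^b)^* V_[::] u = V_b u], as required.

    The Hilbert spaces are completions.  The completion of a space with a
    semi-inner product is taken to be the space of its bounded conjugate-linear
    functionals.  Such a functional is approximated by vectors, uniformly on
    the unit ball ([almost_riesz]): this gives the inner product of the
    completion, and, in a space which is already complete, the Riesz theorem and
    the existence of adjoints. *)

Set Implicit Arguments.
Unset Strict Implicit.
Unset Printing Implicit Defensive.

Import Order.TTheory GRing.Theory Num.Theory.
Import numFieldNormedType.Exports.

Local Open Scope classical_set_scope.
Local Open Scope ring_scope.
Local Open Scope complex_scope.

(** * Complex numbers *)

Lemma eqW {disp : Order.disp_t} {T : porderType disp} (x y : T) :
  x = y -> (x <= y)%O.
Proof. by move=> ->. Qed.

Section ComplexLemmas.
Context {R : realType}.
Implicit Types x y z m b e : R[i].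

Lemma addc_conj_le_norm z : z + z^*%R <= `|z| *+ 2.
Proof.
have zr : z + z^*%R \is Num.real by rewrite CrealE rmorphD /= conjCK addrC.
apply: le_trans (real_ler_norm zr) _.
by rewrite (le_trans (ler_normD _ _)) // norm_conjC mulr2n.
Qed.

(** The discriminant argument behind the Cauchy-Schwarz inequality; the
    parameter [b] may vanish, which is the degenerate case of a semi-inner
    product. *)
Lemma le_of_quadratic_ge0 m b e : 0 <= m -> 0 <= b -> 0 <= e ->
  (forall s, 0 <= s -> 0 <= s ^+ 2 * m * b - (s * m) *+ 2 + e) -> m <= e * b.
Proof.
move=> m0 b0 e0 H.
have [b0'|bN0] := eqVneq b 0.
  rewrite b0' mulr0; have [->//|mN0] := eqVneq m 0.
  (* The form is affine and decreasing in [s]: a large [s] contradicts [H]. *)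
  have m_gt0 : 0 < m by rewrite lt_def mN0.
  have := H ((e + 1) / m) (divr_ge0 (addr_ge0 e0 ler01) m0).
  rewrite b0' mulr0 add0r divfK// mulr2n opprD -addrA.
  have -> : - (e + 1) + (- (e + 1) + e) = - (e + 2) by ring.
  rewrite oppr_ge0 => /(lt_le_trans _) -/(_ 0).
  by rewrite ltr_wpDl // ltxx => /(_ isT).
have b_gt0 : 0 < b by rewrite lt_def bN0.
have := H b^-1; rewrite invr_ge0 => /(_ b0).
have -> : b^-1 ^+ 2 * m * b - b^-1 * m *+ 2 + e = e - m / b.
  by rewrite mulr2n; field.
by rewrite subr_ge0 ler_pdivrMr.
Qed.

Lemma sqr_normD (x y : R[i]) : `|x + y| ^+ 2 <= (`|x| ^+ 2 + `|y| ^+ 2) *+ 2.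
Proof.
apply: (@le_trans _ _ ((`|x| + `|y|) ^+ 2)).
  by rewrite lerXn2r ?nnegrE ?addr_ge0 // ler_normD.
rewrite -subr_ge0.
have -> : (`|x| ^+ 2 + `|y| ^+ 2) *+ 2 - (`|x| + `|y|) ^+ 2 = (`|x| - `|y|) ^+ 2.
  by rewrite mulr2n; ring.
by rewrite real_exprn_even_ge0 // realB // normr_real.
Qed.

(** The linear term of [form_sqrD] at [a = - (s * d)], where [d] is its
    coefficient: this choice of phase makes it real and negative. *)
Lemma conj_real_mul (s d : R[i]) : 0 <= s ->
  (- (s * d))^*%R * d + ((- (s * d))^*%R * d)^*%R = - (s * `|d| ^+ 2) *+ 2.
Proof.
move=> s0; rewrite rmorphN rmorphM /= (conj_Creal (ger0_real s0)) normCK.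
rewrite rmorphM rmorphN rmorphM /= (conj_Creal (ger0_real s0)) conjCK mulr2n.
by ring.
Qed.

Lemma sqr_norm_mul_le (a x c b : R[i]) :
  `|x| ^+ 2 <= c * b -> `|a * x| ^+ 2 <= `|a| ^+ 2 * c * b.
Proof. by move=> xcb; rewrite normrM exprMn -mulrA ler_wpM2l ?exprn_ge0. Qed.

End ComplexLemmas.

(** * Semi-inner products *)

Record semi_inner (R : realType) (V : lmodType R[i]) := SemiInner {
  form :> V -> V -> R[i];
  form_linear : forall a u v w, form (a *: u + v) w = a * form u w + form v w;
  form_conj : forall u v, form v u = (form u v)^*%R;
  form_ge0 : forall u, 0 <= form u u }.

Section SemiInner.
Context {R : realType} {V : lmodType R[i]} (B : semi_inner V).
Implicit Types (u v w : V) (a e c : R[i]).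

Lemma formDl u v w : B (u + v) w = B u w + B v w.
Proof. by rewrite -[u]scale1r form_linear mul1r scale1r. Qed.

Lemma form0l w : B 0 w = 0.
Proof. by apply: (addrI (B 0 w)); rewrite -formDl !addr0. Qed.

Lemma formZl a u w : B (a *: u) w = a * B u w.
Proof. by rewrite -[a *: u]addr0 form_linear form0l addr0. Qed.

Lemma formBl u v w : B (u - v) w = B u w - B v w.
Proof. by rewrite formDl -scaleN1r formZl mulN1r. Qed.

Lemma formDr u v w : B u (v + w) = B u v + B u w.
Proof. by rewrite form_conj formDl rmorphD /= -!form_conj. Qed.

Lemma formZr a u v : B u (a *: v) = a^*%R * B u v.
Proof. by rewrite form_conj formZl rmorphM /= -form_conj. Qed.

Lemma form_sqrD a u v :
  B (u + a *: v) (u + a *: v) =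
  B u u + (a^*%R * B u v + (a^*%R * B u v)^*%R) + `|a| ^+ 2 * B v v.
Proof.
rewrite formDl !formDr !formZl !formZr rmorphM /= conjCK -form_conj normCK.
by ring.
Qed.

Lemma form_real u : B u u \is Num.real. Proof. exact/ger0_real/form_ge0. Qed.

Lemma form_CauchySchwarz u v : `|B u v| ^+ 2 <= B u u * B v v.
Proof.
apply: le_of_quadratic_ge0; rewrite ?exprn_ge0 ?form_ge0 // => s s0.
have := form_ge0 B (u + - (s * B u v) *: v).
rewrite form_sqrD conj_real_mul // normrN normrM (ger0_norm s0) exprMn.
by move/le_trans; apply; apply/eqW; ring.
Qed.

Definition functional_bound (f : V -> R[i]) c : Prop :=
  0 <= c /\ forall v, `|f v| ^+ 2 <= c * B v v.

Definition bounded_functional (f : V -> R[i]) : Prop :=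
  (forall a u v, f (a *: u + v) = a^*%R * f u + f v) /\
  exists c, functional_bound f c.

Lemma form_functional u : functional_bound (B u) (B u u).
Proof. by split=> [|v]; [exact: form_ge0|exact: form_CauchySchwarz]. Qed.

Lemma bounded_form u : bounded_functional (B u).
Proof.
split; last by exists (B u u); exact: form_functional.
by move=> a v w; rewrite formDr formZr.
Qed.

Definition approximates (f : V -> R[i]) e w : Prop :=
  forall v, `|f v - B w v| ^+ 2 <= e * B v v.

(** An almost minimiser [w] of [v |-> B v v - 2 Re (f v)] represents [f] up to
    a small error: at [w + t v] the functional exceeds its value at [w] by
    [2 Re (conj t (B w v - f v)) + |t|^2 B v v], which cannot be less than [- e],
    and the choice of [t] in the Cauchy-Schwarz inequality bounds
    [B w v - f v].  The error is uniform in [v], so that almost representatives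
    can replace the limit in spaces that are not complete. *)
Lemma almost_riesz f e : bounded_functional f -> 0 < e ->
  exists w, approximates f e w.
Proof.
move=> [flin [c [c0 fc]]] e0.
pose q v := B v v - (f v + (f v)^*%R).
have qreal v : q v \is Num.real.
  by rewrite realB ?form_real // CrealE rmorphD /= conjCK addrC.
have qlb v : - c <= q v.
  rewrite lerNl opprB lerBlDr (le_trans (addc_conj_le_norm _)) //.
  rewrite -ler_sqr ?nnegrE ?addr_ge0 ?form_ge0 ?mulrn_wge0 //.
  have -> : (`|f v| *+ 2) ^+ 2 = 4 * `|f v| ^+ 2 by rewrite mulr2n; ring.
  apply: (@le_trans _ _ (4 * (c * B v v))); first by rewrite ler_pM2l.
  rewrite -subr_ge0.
  have -> : (c + B v v) ^+ 2 - 4 * (c * B v v) = (c - B v v) ^+ 2 by ring.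
  by rewrite real_exprn_even_ge0 // realB ?form_real // ger0_real.
have ReqE v : (complex.Re (q v))%:C = q v by rewrite RRe_real.
have er : (complex.Re e)%:C = e by rewrite RRe_real // gtr0_real.
have [w qw] : exists w, forall v, q w - e <= q v.
  pose E : set R := [set complex.Re (q v) | v in setT].
  have infE : has_inf E.
    split; first by exists (complex.Re (q 0)), 0.
    exists (complex.Re (- c)) => _ [v _ <-].
    by have := qlb v; rewrite lecE => /andP[].
  have Re_e : 0 < complex.Re e by rewrite -ltcR er.
  have [_ [w _ <-] qw] := inf_adherent Re_e infE.
  exists w => v; rewrite lerBlDr -ReqE -[q v]ReqE -er -rmorphD /= lecR.
  rewrite (le_trans (ltW qw)) // lerD2r.
  by apply: ge_inf; [exact: infE.2|exists v].
exists w => v; apply: le_of_quadratic_ge0;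
  rewrite ?exprn_ge0 ?form_ge0 ?(ltW e0) // => s s0.
(* [d] is the coefficient of the linear term at the almost minimiser [w]. *)
pose d := B w v - f v.
have := qw (w + - (s * d) *: v).
have fE : f (w + - (s * d) *: v) = (- (s * d))^*%R * f v + f w.
  by rewrite addrC flin.
rewrite -subr_ge0 /q form_sqrD fE.
set t := - (s * d).
have -> : B w w + (t^*%R * B w v + (t^*%R * B w v)^*%R) + `|t| ^+ 2 * B v v
   - (t^*%R * f v + f w + (t^*%R * f v + f w)^*%R)
   - (B w w - (f w + (f w)^*%R) - e)
  = (t^*%R * d + (t^*%R * d)^*%R) + `|t| ^+ 2 * B v v + e.
  by rewrite /d !rmorphD !rmorphM /= !rmorphB /=; ring.
rewrite /t conj_real_mul // normrN normrM (ger0_norm s0) exprMn.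
by rewrite /d distrC; move/le_trans; apply; apply/eqW; ring.
Qed.

(** The error bounds can be evaluated at [w1 - w2] itself, so almost
    representatives of one functional form a Cauchy sequence. *)
Lemma approximates_near f e1 e2 w1 w2 : 0 <= e1 -> 0 <= e2 ->
  approximates f e1 w1 -> approximates f e2 w2 ->
  B (w1 - w2) (w1 - w2) <= (e1 + e2) *+ 2.
Proof.
move=> e1_ge0 e2_ge0 a1 a2; set d := w1 - w2.
have [->|dN0] := eqVneq (B d d) 0; first by rewrite mulrn_wge0 ?addr_ge0.
have d_gt0 : 0 < B d d by rewrite lt_def dN0 form_ge0.
rewrite -(ler_pM2r d_gt0) -{1}[B d d]ger0_norm ?form_ge0 //.
rewrite -[X in _ * X]ger0_norm ?form_ge0 //.
rewrite -expr2.
have {1}-> : B d d = - (f d - B w1 d) + (f d - B w2 d).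
  by rewrite {1}/d formBl; ring.
rewrite (le_trans (sqr_normD _ _)) // normrN mulrnAl lerMn2r /= mulrDl.
by apply: lerD; [exact: a1|exact: a2].
Qed.

End SemiInner.

(** * Limits of complex numbers *)

Section ComplexTopology.
Context {R : realType}.

(** Both coordinates are Cauchy, so this is the completeness of the reals. *)
Lemma complex_complete (F : set_system R[i]^o) :
  ProperFilter F -> cauchy F -> cvg F.
Proof.
move=> FF /cauchyP Fc.
have cvg_part (p : R[i] -> R) : (forall x y, p (x - y) = p x - p y) ->
    (forall x, `|p x|%:C <= `|x|) -> cvg (p @ F).
  move=> pB pnorm; apply: R_complete; apply/cauchyP => e e0.
  have [|x Fx] := Fc e%:C; first by rewrite ltcR.
  exists (p x); change (F (p @^-1` ball (p x) e)).
  apply: filterS Fx => y; rewrite -!ball_normE /ball_ /= -pB -ltcR.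
  exact/le_lt_trans/pnorm.
have /cvg_ex[/= a Fa] : cvg (@complex.Re R @ F).
  apply: cvg_part => [[? ?] [? ?]//|x]; exact: normc_ge_Re.
have /cvg_ex[/= b Fb] : cvg (@complex.Im R @ F).
  apply: cvg_part => [[? ?] [? ?]//|[x y]].
  by rewrite normc_def lecR /= -sqrtr_sqr ler_wsqrtr // lerDr sqr_ge0.
apply/cvg_ex; exists (a +i* b); apply/cvgrPdist_lt => /= e e0.
have er : (complex.Re e)%:C = e by rewrite RRe_real // gtr0_real.
have e20 : 0 < complex.Re e / 2 by rewrite divr_gt0 // -ltcR er.
move/cvgrPdist_lt : Fa => /(_ _ e20) Fa.
move/cvgrPdist_lt : Fb => /(_ _ e20) Fb.
apply: filterS2 Fa Fb => -[x y] /= Fa Fb.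
rewrite (_ : _ - _ = (a - x)%:C + 'i * (b - y)%:C); last by simpc.
rewrite (le_lt_trans (ler_normD _ _)) // normrM.
rewrite !normc_def /= !(expr0n, expr1n, add0r, addr0) sqrtr1 mul1r !sqrtr_sqr.
by rewrite -rmorphD /= -er ltcR [ltRHS]splitr ltrD.
Qed.

Lemma cvg_complex_harmonic : (n.+1%:R^-1 : R[i]^o) @[n --> \oo] --> (0 : R[i]^o).
Proof.
apply/cvgr0Pnorm_lt => /= e e0.
have er : (complex.Re e)%:C = e by rewrite RRe_real // gtr0_real.
have e20 : 0 < complex.Re e by rewrite -ltcR er.
have /cvgr0Pnorm_lt/(_ _ e20) := @cvg_harmonic R.
apply: filterS => n /=; rewrite -ltcR er; apply: le_lt_trans.
by rewrite !ger0_norm ?invr_ge0 // fmorphV rmorph_nat.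
Qed.

(** Estimates on semi-inner products come squared; this form of the squeeze
    theorem avoids square roots. *)
Lemma sqr_norm_cvg0 (u b : nat -> R[i]^o) : (forall n, `|u n| ^+ 2 <= b n) ->
  b n @[n --> \oo] --> (0 : R[i]^o) -> u n @[n --> \oo] --> (0 : R[i]^o).
Proof.
move=> ub /cvgr0Pnorm_lt b0; apply/cvgr0Pnorm_lt => /= e e0.
apply: filterS (b0 _ (exprn_gt0 2 e0)) => n /=.
have b_ge0 : 0 <= b n by rewrite (le_trans _ (ub n)) // exprn_ge0.
rewrite ger0_norm // => /(le_lt_trans (ub n)).
by rewrite ltr_pXn2r ?nnegrE // ltW.
Qed.

End ComplexTopology.

Section LimitOrder.
Context {R : realType} {T : Type} {F : set_system T} {FF : ProperFilter F}.
Implicit Types (u v : T -> R[i]^o) (a b : R[i]^o).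

Lemma complex_limit_unique u a b :
  u n @[n --> F] --> a -> u n @[n --> F] --> b -> a = b.
Proof. by move=> ua ub; rewrite -(norm_cvg_lim ua) -(norm_cvg_lim ub). Qed.

Lemma cvg_complex_eq u v a b : u n @[n --> F] --> a -> u =1 v -> a = b ->
  v n @[n --> F] --> b.
Proof. by move=> ua /funext <- <-. Qed.

Lemma cvg_conj u a : u n @[n --> F] --> a ->
  ((u n)^*%R : R[i]^o) @[n --> F] --> (a^*%R : R[i]^o).
Proof.
move=> /cvgrPdist_lt ul; apply/cvgrPdist_lt => e /ul.
by apply: filterS => n; rewrite -rmorphB norm_conjC.
Qed.

Lemma cvg_complex_norm u a : u n @[n --> F] --> a ->
  (`|u n| : R[i]^o) @[n --> F] --> (`|a| : R[i]^o).
Proof. exact: cvg_norm. Qed.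

Lemma cvg_complexM u v a b : u n @[n --> F] --> a -> v n @[n --> F] --> b ->
  ((u n : R[i]) * (v n : R[i]) : R[i]^o) @[n --> F] -->
    ((a : R[i]) * (b : R[i]) : R[i]^o).
Proof. by move=> ua vb; exact: (cvgM ua vb). Qed.

Lemma cvg_complexZ u a (b : R[i]) : u n @[n --> F] --> a ->
  (b * (u n : R[i]) : R[i]^o) @[n --> F] --> (b * (a : R[i]) : R[i]^o).
Proof.
by move=> ua; exact: (cvg_complexM (@cvg_cst _ (b : R[i]^o) _ F _) ua).
Qed.

Lemma cvg_complex_ge0 u a :
  (\forall n \near F, 0 <= u n) -> u n @[n --> F] --> a -> 0 <= a.
Proof.
move=> u0 ua; have normua : (`|u n| : R[i]^o) @[n --> F] --> a.
  apply: cvg_trans ua; apply: near_eq_cvg.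
  by apply: filterS u0 => n /= un; rewrite ger0_norm.
by rewrite (complex_limit_unique normua (cvg_complex_norm ua)).
Qed.

Lemma cvg_complex_le u v a b : (\forall n \near F, u n <= v n) ->
  u n @[n --> F] --> a -> v n @[n --> F] --> b -> a <= b.
Proof.
move=> uv ua vb; rewrite -subr_ge0.
have vu : (v n - u n) @[n --> F] --> b - a by exact: cvgB vb ua.
by apply: cvg_complex_ge0 vu; apply: filterS uv => n; rewrite subr_ge0.
Qed.

End LimitOrder.

(** * The pairing of bounded functionals *)

Section Pairing.
Context {R : realType} {V : lmodType R[i]} (B : semi_inner V).
Local Notation C := R[i]^o.
Implicit Types (u v w : V) (a e c : R[i]) (f g : V -> R[i]^o).

Lemma functionalB f u v : bounded_functional B f -> f (u - v) = f u - f v.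
Proof.
move=> [flin _]; rewrite -[- v]scaleN1r addrC flin rmorphN rmorph1 mulN1r.
by rewrite addrC.
Qed.

Lemma functional_bound_dist f c u v : bounded_functional B f ->
  functional_bound B f c -> `|f u - f v| ^+ 2 <= c * B (u - v) (u - v).
Proof. by move=> fB [_ fc]; rewrite -(functionalB _ _ fB). Qed.

(** As in [approximates_near], the error bound is evaluated at the vector
    itself. *)
Lemma approximates_bound g c e w : functional_bound B g c -> 0 <= e ->
  approximates B g e w -> B w w <= (c + e) *+ 2.
Proof.
move=> [c0 gc] e0 a.
have [->|wN0] := eqVneq (B w w) 0; first by rewrite mulrn_wge0 ?addr_ge0.
have w_gt0 : 0 < B w w by rewrite lt_def wN0 form_ge0.
rewrite -(ler_pM2r w_gt0) -expr2 -{1}[B w w]ger0_norm ?form_ge0 //.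
have {1}-> : B w w = g w + - (g w - B w w) by ring.
rewrite (le_trans (sqr_normD _ _)) // normrN mulrnAl lerMn2r /= mulrDl.
by apply: lerD; [exact: gc|exact: a].
Qed.

Definition approximant g n : V := xget 0 [set w | approximates B g n.+1%:R^-1 w].

Lemma approximantP g n : bounded_functional B g ->
  approximates B g n.+1%:R^-1 (approximant g n).
Proof.
move=> gB; have : exists w, approximates B g n.+1%:R^-1 w.
  by apply: almost_riesz; rewrite ?invr_gt0.
by exact: xgetPex.
Qed.

(** If [g] is represented by the limit of its approximants, then the value of
    [f] at this limit is the inner product of [f] and [g]. *)
Definition pairing f g : C := lim (f (approximant g n) @[n --> \oo]).

Lemma approximant_eventually g e : bounded_functional B g -> 0 < e ->
  exists N, forall n, (N <= n)%N -> approximates B g e (approximant g n).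
Proof.
move=> gB e0; have /cvgr0Pnorm_lt/(_ e e0) [N _ hN] := @cvg_complex_harmonic R.
exists N => n /hN /=; rewrite ger0_norm ?invr_ge0 // => /ltW ne v.
by apply: le_trans (approximantP n gB v) _; rewrite ler_wpM2r ?form_ge0.
Qed.

Lemma cvg_approximant f g : bounded_functional B f -> bounded_functional B g ->
  f (approximant g n) @[n --> \oo] --> pairing f g.
Proof.
move=> fB gB; have [_ [c fc]] := fB; have [c0 _] := fc.
apply: complex_complete; apply/cauchyP => e e0.
have k0 : 0 < (c + 1) *+ 4 by rewrite pmulrn_rgt0 // ltr_wpDl.
(* The squared distance below is at most [c * (d *+ 4)]; the extra 1 makes the
   inequality strict and the denominator nonzero. *)
pose d := e ^+ 2 / ((c + 1) *+ 4).
have d0 : 0 < d by rewrite divr_gt0 ?exprn_gt0.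
have [N hN] := approximant_eventually gB d0.
exists (f (approximant g N)); exists N => // n /= Nn.
rewrite -ball_normE /ball_ /= -(@ltr_pXn2r _ 2) ?nnegrE ?(ltW e0) //.
apply: le_lt_trans (functional_bound_dist _ _ fB fc) _.
have B_le := approximates_near (ltW d0) (ltW d0) (hN N (leqnn N)) (hN n Nn).
apply: le_lt_trans (ler_wpM2l c0 B_le) _.
have -> : e ^+ 2 = (c + 1) * (d + d) *+ 2.
  by rewrite -[LHS](@divfK _ ((c + 1) *+ 4)) ?gt_eqF // -/d; ring.
by rewrite -mulrnAr ltr_pM2r ?ltrDl // pmulrn_lgt0 // addr_gt0.
Qed.

(** Any sequence of almost representatives of [g] computes the pairing with
    [g], hence the choice made in [approximant] is immaterial. *)
Lemma cvg_pairing f g (w : nat -> V) (e : nat -> C) :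
  bounded_functional B f -> bounded_functional B g ->
  (forall n, 0 <= e n) -> e n @[n --> \oo] --> (0 : C) ->
  (forall n, approximates B g (e n) (w n)) ->
  f (w n) @[n --> \oo] --> pairing f g.
Proof.
move=> fB gB e0 ecvg we; have [_ [c fc]] := fB; have [c0 _] := fc.
pose b n : C := c * ((e n + n.+1%:R^-1) *+ 2).
have b0 : b n @[n --> \oo] --> (0 : C).
  rewrite (_ : 0 = c * ((0 + 0) *+ 2) :> C); last by rewrite addr0 mul0rn mulr0.
  apply: cvgM; first exact: cvg_cst.
  by apply: cvgMn; apply: cvgD => //; exact: cvg_complex_harmonic.
have d0 : (f (w n) - f (approximant g n)) @[n --> \oo] --> (0 : C).
  apply: sqr_norm_cvg0 b0 => n.
  apply: le_trans (functional_bound_dist _ _ fB fc) _.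
  rewrite ler_wpM2l //; apply: approximates_near (we n) (approximantP n gB) => //.
  by rewrite invr_ge0.
rewrite (_ : (fun n => f (w n)) =
  fun n => (f (w n) - f (approximant g n)) + f (approximant g n)).
  by rewrite -[pairing f g]add0r; apply: cvgD d0 _; exact: cvg_approximant.
by apply/funext => n; rewrite subrK.
Qed.

Lemma pairing_form f u : bounded_functional B f -> pairing f (B u) = f u.
Proof.
move=> fB; apply: (complex_limit_unique (u := fun=> f u) (F := \oo));
  last exact: cvg_cst.
apply: (@cvg_pairing f (B u) (fun=> u) (fun=> 0)) => //.
- exact: bounded_form.
- exact: cvg_cst.
- by move=> n v; rewrite subrr normr0 expr0n mul0r.
Qed.

Lemma pairing_linear a f1 f2 g : bounded_functional B f1 ->
  bounded_functional B f2 -> bounded_functional B g ->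
  bounded_functional B (a *: f1 + f2 : V -> C) ->
  pairing (a *: f1 + f2 : V -> C) g = a * pairing f1 g + pairing f2 g.
Proof.
move=> f1B f2B gB fB.
apply: complex_limit_unique (cvg_approximant fB gB) _.
apply: cvgD; last exact: cvg_approximant.
by apply: cvgM; [exact: cvg_cst|exact: cvg_approximant].
Qed.

(** The error in [approximates f] is proportional to [B w w], which stays
    bounded along the approximants [w] of [g]. *)
Lemma cvg_approximant_form f g : bounded_functional B f -> bounded_functional B g ->
  (f (approximant g n) - B (approximant f n) (approximant g n))
    @[n --> \oo] --> (0 : C).
Proof.
move=> fB gB; have [_ [c gc]] := gB; have [c0 _] := gc.
pose b n : C := n.+1%:R^-1 * ((c + 1) *+ 2).
apply: (@sqr_norm_cvg0 _ _ b) => [n|].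
  apply: le_trans (approximantP n fB _) _; rewrite ler_wpM2l ?invr_ge0 //.
  apply: le_trans (approximates_bound gc _ (approximantP n gB)) _.
    by rewrite invr_ge0.
  by rewrite lerMn2r lerD2l invf_le1 ?ler1n.
rewrite (_ : 0 = 0 * ((c + 1) *+ 2) :> C); last by rewrite mul0r.
by apply: cvgM; [exact: cvg_complex_harmonic|exact: cvg_cst].
Qed.

Lemma pairing_conj f g : bounded_functional B f -> bounded_functional B g ->
  pairing g f = (pairing f g)^*%R.
Proof.
move=> fB gB; apply: complex_limit_unique (cvg_approximant gB fB) _.
apply: cvg_complex_eq (cvgD (cvg_approximant_form gB fB)
  (cvgB (cvg_conj (cvg_approximant fB gB))
        (cvg_conj (cvg_approximant_form fB gB)))) _ _.
  by move=> n /=; rewrite !fctE /= rmorphB /= -form_conj; ring.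
by rewrite rmorph0 subr0 add0r.
Qed.

Lemma cvg_approximant_sqr f : bounded_functional B f ->
  B (approximant f n) (approximant f n) @[n --> \oo] --> pairing f f.
Proof.
move=> fB.
apply: cvg_complex_eq
  (cvgB (cvg_approximant fB fB) (cvg_approximant_form fB fB)) _ _.
  by move=> n /=; rewrite !fctE /=; ring.
by rewrite subr0.
Qed.

Lemma pairing_ge0 f : bounded_functional B f -> 0 <= pairing f f.
Proof.
move/cvg_approximant_sqr; apply: cvg_complex_ge0; apply: nearW => n.
exact: form_ge0.
Qed.

(** With [pairing_le], this says that [pairing f f] is the square of the
    operator norm of [f]. *)
Lemma functional_bound_pairing f : bounded_functional B f ->
  functional_bound B f (pairing f f).
Proof.
move=> fB; split=> [|v]; first exact: pairing_ge0.
have fv : B (approximant f n) v @[n --> \oo] --> f v.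
  pose b n : C := n.+1%:R^-1 * B v v.
  have b0 : b n @[n --> \oo] --> (0 : C).
    rewrite (_ : 0 = 0 * B v v :> C); last by rewrite mul0r.
    by apply: cvgM; [exact: cvg_complex_harmonic|exact: cvg_cst].
  apply: cvg_complex_eq (cvgB (@cvg_cst _ (f v : C) _ \oo _)
    (sqr_norm_cvg0 (fun n => approximantP n fB v) b0)) _ _.
    by move=> n /=; rewrite !fctE /=; ring.
  by rewrite subr0.
have nfv : `|B (approximant f n) v| @[n --> \oo] --> (`|f v| : C).
  exact: cvg_complex_norm fv.
rewrite expr2 [leRHS]mulrC; refine (cvg_complex_le _ (cvg_complexM nfv nfv)
  (cvg_complexZ (b := B v v) (cvg_approximant_sqr fB))); apply: nearW => n.
by rewrite [leRHS]mulrC -expr2; exact: form_CauchySchwarz.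
Qed.

Lemma pairing_le f c : bounded_functional B f -> functional_bound B f c ->
  pairing f f <= c.
Proof.
move=> fB [c0 fc]; set p := pairing f f.
have p0 : 0 <= p := pairing_ge0 fB.
have pp : p * p <= c * p.
  have np : `|f (approximant f n)| @[n --> \oo] --> (`|p| : C).
    exact: cvg_complex_norm (cvg_approximant fB fB).
  rewrite -[in leLHS](ger0_norm p0); refine (cvg_complex_le _ (cvg_complexM np np)
    (cvg_complexZ (b := c) (cvg_approximant_sqr fB))); apply: nearW => n.
  by rewrite -expr2.
have [->//|pN0] := eqVneq p 0.
by rewrite -(@ler_pM2r _ p) // lt_def pN0.
Qed.

End Pairing.

(** * The completion of a semi-inner product space *)

Section SemiNorm.
Context {R : realType} {V : lmodType R[i]} (B : semi_inner V).
Implicit Types (u v w : V).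

Lemma form_CauchySchwarz_sqrt u v :
  `|B u v| <= sqrtC (B u u) * sqrtC (B v v).
Proof.
have sqrt_ge0 w : 0 <= sqrtC (B w w) by rewrite sqrtC_ge0 form_ge0.
rewrite -(@ler_pXn2r _ 2) ?nnegrE ?mulr_ge0 // exprMn !sqrtCK.
exact: form_CauchySchwarz.
Qed.

Lemma form_triangle u v :
  sqrtC (B (u + v) (u + v)) <= sqrtC (B u u) + sqrtC (B v v).
Proof.
have sqrt_ge0 w : 0 <= sqrtC (B w w) by rewrite sqrtC_ge0 form_ge0.
rewrite -(@ler_pXn2r _ 2) ?nnegrE ?addr_ge0 // sqrrD !sqrtCK.
have := form_sqrD B 1 u v; rewrite scale1r normr1 expr1n rmorph1 !mul1r => ->.
rewrite lerD2r lerD2l (le_trans (addc_conj_le_norm _)) // lerMn2r /=.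
exact: form_CauchySchwarz_sqrt.
Qed.

Lemma sqrt_formZ (a : R[i]) u :
  sqrtC (B (a *: u) (a *: u)) = `|a| * sqrtC (B u u).
Proof.
rewrite formZl formZr mulrA -normCK sqrtCM ?nnegrE ?exprn_ge0 ?form_ge0 //.
by rewrite sqrCK.
Qed.

End SemiNorm.

Section Completion.
Context {R : realType} {V : lmodType R[i]} (B : semi_inner V).
Implicit Types (f g : V -> R[i]^o).

(** Functionals rather than classes of Cauchy sequences: the quotient by the
    null vectors of [B] comes for free, since these are killed by every bounded
    functional. *)
Definition functional_pred : {pred V -> R[i]^o} :=
  fun f => `[< bounded_functional B f >].

Lemma functional_submod_closed : submod_closed functional_pred.
Proof.
split=> [|a f g /asboolP[flin [c [c0 fc]]] /asboolP[glin [e [e0 ge]]]];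
  apply/asboolP.
  split=> [b u v|]; first by rewrite /= mulr0 addr0.
  exists 0; split=> // v; by rewrite normr0 expr0n mul0r.
have sE (x : R[i]^o) : a *: x = a * x by [].
split=> [b u v|].
  by rewrite !fctE flin glin !sE; ring.
exists ((`|a| ^+ 2 * c + e) *+ 2); split=> [|v].
  by rewrite mulrn_wge0 ?addr_ge0 ?mulr_ge0 ?exprn_ge0.
rewrite !fctE (le_trans (sqr_normD _ _)) // mulrnAl lerMn2r /= mulrDl.
apply: lerD (ge v); exact: sqr_norm_mul_le (fc v).
Qed.

HB.instance Definition _ :=
  GRing.isSubmodClosed.Build _ _ functional_pred functional_submod_closed.

Record completion := Completion {
  functional :> V -> R[i]^o ; functionalP : functional \in functional_pred }.

HB.instance Definition _ := [isSub for functional].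
HB.instance Definition _ := [Choice of completion by <:].
HB.instance Definition _ := [SubChoice_isSubLmodule of completion by <:].

Implicit Types (x y z : completion).

Lemma completion_bounded x : bounded_functional B x.
Proof. exact/asboolP/functionalP. Qed.

Lemma completionDE x y v : (x + y) v = x v + y v. Proof. by []. Qed.
Lemma completionZE a x v : (a *: x) v = a * x v. Proof. by []. Qed.

Lemma completion_ext x y : (forall v, x v = y v) -> x = y.
Proof. by move=> xy; apply/val_inj/funext. Qed.

Fact completion_linear a x y z :
  pairing B (a *: x + y) z = a * pairing B x z + pairing B y z.
Proof.
exact: (pairing_linear (completion_bounded x) (completion_bounded y)
  (completion_bounded z) (completion_bounded (a *: x + y))).
Qed.

Definition completion_form := SemiInner completion_linear
  (fun x y => pairing_conj (completion_bounded x) (completion_bounded y))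
  (fun x => pairing_ge0 (completion_bounded x)).

Let norm x := sqrtC (completion_form x x).

Lemma completion_norm_eq0 x : norm x = 0 -> x = 0.
Proof.
move=> /eqP; rewrite sqrtC_eq0 => /eqP x0; apply: completion_ext => v.
have xv : `|x v| ^+ 2 <= completion_form x x * B v v.
  exact: (functional_bound_pairing (completion_bounded x)).2.
rewrite x0 mul0r in xv.
apply/eqP; rewrite -normr_eq0 -sqrf_eq0; apply/eqP/le_anti.
by rewrite xv exprn_ge0.
Qed.

HB.instance Definition _ := Lmodule_isNormed.Build R[i] completion
  (form_triangle completion_form) (sqrt_formZ completion_form) completion_norm_eq0.

Lemma completion_normE x : `|x| ^+ 2 = completion_form x x.
Proof. exact: sqrtCK. Qed.

End Completion.

Section CompletionHilbert.
Context {R : realType} {V : lmodType R[i]} (B : semi_inner V).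
Implicit Types (x y z : completion B).

Lemma completion_eval_le x v : `|x v| <= `|x| * sqrtC (B v v).
Proof.
have s0 : 0 <= sqrtC (B v v) by rewrite sqrtC_ge0 form_ge0.
rewrite -(@ler_pXn2r _ 2) ?nnegrE ?mulr_ge0 // exprMn !sqrtCK.
exact: (functional_bound_pairing (completion_bounded x)).2.
Qed.

Lemma completion_norm_le x (e : R[i]) : 0 <= e ->
  (forall v, `|x v| <= e * sqrtC (B v v)) -> `|x| <= e.
Proof.
move=> e0 xe; rewrite -(@ler_pXn2r _ 2) ?nnegrE // completion_normE.
apply: (pairing_le (completion_bounded x)); split=> [|v]; first exact: exprn_ge0.
rewrite -[X in _ * X]sqrtCK -exprMn ler_pXn2r ?nnegrE //.
by rewrite mulr_ge0 // sqrtC_ge0 form_ge0.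
Qed.

(** Evaluations are uniformly continuous, so a Cauchy filter converges
    pointwise to a functional.  The pointwise estimates, uniform on the unit
    ball, pass to the limit, and bound the norm of the difference. *)
Lemma completion_complete (F : set_system (completion B)) :
  ProperFilter F -> cauchy F -> cvg F.
Proof.
move=> FF /cauchyP Fc.
have evalB x y v : (x - y) v = x v - y v by [].
have s0 v : 0 <= sqrtC (B v v) by rewrite sqrtC_ge0 form_ge0.
pose ev v : completion B -> R[i]^o := fun x => x v.
have near_eval x e v : F (ball x e) ->
    \forall y \near F, `|x v - ev v y| <= e * sqrtC (B v v).
  apply: filterS => y; rewrite -ball_normE /ball_ /= => xy.
  by rewrite -evalB (le_trans (completion_eval_le _ _)) // ler_wpM2r // ltW.
have eval_cvg v : cvg (ev v @ F).
  apply: complex_complete; apply/cauchyP => e e0.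
  have d0 : 0 < e / (sqrtC (B v v) + 1) by rewrite divr_gt0 // ltr_wpDl.
  have [x /(near_eval _ _ v) Fx] := Fc _ d0.
  exists (x v); apply: filterS Fx => y /=; rewrite -ball_normE /ball_ /=.
  move=> /le_lt_trans; apply.
  by rewrite mulrAC ltr_pdivrMr ?ltr_wpDl // mulrDr mulr1 ltrDl.
pose phi v : R[i]^o := lim (ev v @ F).
have phi_cvg v : ev v @ F --> phi v by exact: eval_cvg.
have phi_near x e : F (ball x e) -> forall v, `|x v - phi v| <= e * sqrtC (B v v).
  move=> Fx v; apply: (cvg_complex_le (near_eval _ _ v Fx) _ (cvg_cst _)).
  apply: cvg_complex_norm; apply: cvgB; [exact: cvg_cst|exact: phi_cvg].
have phiB : bounded_functional B phi.
  split=> [a u v|].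
    apply: complex_limit_unique (phi_cvg _) _.
    apply: cvg_complex_eq (cvgD (cvg_complexZ (phi_cvg u)) (phi_cvg v)) _ (erefl _).
    by move=> x; rewrite /= /ev (completion_bounded x).1.
  have [x Fx] := Fc 1 ltr01.
  have [_ [c [c0 xc]]] := completion_bounded x.
  exists ((c + 1) *+ 2); split=> [|v]; first by rewrite mulrn_wge0 ?addr_ge0.
  have -> : phi v = x v + - (x v - phi v) by ring.
  rewrite (le_trans (sqr_normD _ _)) // mulrnAl lerMn2r /= mulrDl normrN.
  apply: lerD; first exact: xc.
  rewrite mul1r -[leRHS]sqrtCK ler_pXn2r ?nnegrE //.
  by have := phi_near x 1 Fx v; rewrite mul1r.
have phiP : phi \in functional_pred B by exact/asboolP.
apply/cvg_ex; exists (Completion phiP); apply/cvgrPdist_le => /= e e0.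
have [x Fx] := Fc (e / 2) (divr_gt0 e0 (ltr0n _ 2)).
have xphi : `|Completion phiP - x| <= e / 2.
  apply: completion_norm_le => [|v]; first by rewrite divr_ge0 // ltW.
  by rewrite evalB distrC; exact: phi_near.
apply: filterS Fx => y; rewrite -ball_normE /ball_ /= => xy.
rewrite [leRHS]splitr -(subrK x (Completion phiP)) -addrA.
by rewrite (le_trans (ler_normD _ _)) // lerD // ltW.
Qed.

HB.instance Definition _ :=
  Uniform_isComplete.Build (completion B) completion_complete.

Definition completion_inner x y : R[i] := completion_form B x y.

Fact completion_inner_bilinear :
  bilinear_for ( *%R : GRing.Scale.law _ _)
    (Num.conj \; *%R : GRing.Scale.law _ _) completion_inner.
Proof.
split=> [z a x y|x a y z]; rewrite /completion_inner ?formDl ?formZl //.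
by rewrite formDr formZr.
Qed.

HB.instance Definition _ := bilinear_isBilinear.Build _ _ _ _ _ _
  completion_inner completion_inner_bilinear.

Fact completion_inner_hermitian x y :
  completion_inner x y = (-1) ^+ false * Num.conj (completion_inner y x).
Proof. by rewrite expr0 mul1r /completion_inner -form_conj. Qed.

HB.instance Definition _ := isHermitianSesquilinear.Build _ _ _ _
  completion_inner completion_inner_hermitian.

Fact completion_inner_gt0 x : x != 0 -> 0 < completion_inner x x.
Proof.
by rewrite /completion_inner -completion_normE -normr_gt0; exact: exprn_gt0.
Qed.

HB.instance Definition _ :=
  isDotProduct.Build _ _ completion_inner completion_inner_gt0.

Fact completion_inner_norm x : completion_inner x x = `|x| ^+ 2.
Proof. by rewrite completion_normE. Qed.

HB.instance Definition _ :=
  NormedModule_hasInner.Build R (completion B) completion_inner_norm.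

Lemma innerE x y : inner x y = pairing B x y.
Proof. by []. Qed.

End CompletionHilbert.

Section Embedding.
Context {R : realType} {V : lmodType R[i]} (B : semi_inner V).

(** Functionals are conjugate-linear so that this embedding is linear. *)
Definition embed (u : V) : completion B :=
  Completion (introT (asboolP _) (bounded_form B u)).

Lemma embed_linear : linear embed.
Proof. by move=> a u v; apply: completion_ext => w; exact: form_linear. Qed.

(** The reproducing property: evaluating a functional is pairing it with the
    embedded vector. *)
Lemma inner_embed (x : completion B) u : inner x (embed u) = x u.
Proof. exact: (pairing_form u (completion_bounded x)). Qed.

Lemma inner_embed2 u v : inner (embed u) (embed v) = B u v.
Proof. by rewrite inner_embed. Qed.

End Embedding.

(** * The Riesz theorem and adjoints *)

Section HilbertSpaces.
Context {R : realType}.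
Implicit Types G H : hilbertType R.

Lemma inner_linear H a (u v w : H) : '[a *: u + v, w] = a * '[u, w] + '[v, w].
Proof. exact: linearPl. Qed.

Lemma inner_conj H (u v : H) : '[v, u] = ('[u, v])^*%R.
Proof. by rewrite hermitian_subproof expr0 mul1r. Qed.

Lemma inner_ge0 H (u : H) : 0 <= '[u, u].
Proof. by rewrite inner_norm exprn_ge0. Qed.

Definition inner_form H : semi_inner H :=
  SemiInner (@inner_linear H) (@inner_conj H) (@inner_ge0 H).

Lemma inner_formE H (u v : H) : inner_form H u v = '[u, v]. Proof. by []. Qed.

Lemma inner_CauchySchwarz H (u v : H) : `|'[u, v]| <= `|u| * `|v|.
Proof.
rewrite -(@ler_pXn2r _ 2) ?nnegrE ?mulr_ge0 // exprMn -!inner_norm.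
exact: (form_CauchySchwarz (inner_form H)).
Qed.

Lemma inner_ext H (u v : H) : (forall w, '[u, w] = '[v, w]) -> u = v.
Proof.
move=> uv; apply/eqP; rewrite -subr_eq0 -normr_eq0 -sqrf_eq0 -inner_norm.
by rewrite linearBl /= uv subrr.
Qed.

Lemma inner_extr H (u v : H) : (forall w, '[w, u] = '[w, v]) -> u = v.
Proof. by move=> uv; apply: inner_ext => w; rewrite inner_conj uv -inner_conj. Qed.

(** The approximants of [f] form a Cauchy sequence; here its limit exists. *)
Lemma riesz H (f : H -> R[i]^o) : bounded_functional (inner_form H) f ->
  exists z, forall v, f v = '[z, v].
Proof.
move=> fB; pose z := approximant (inner_form H) f.
have z_cvg : cvg (z n @[n --> \oo]).
  apply: cauchy_cvg; apply/cauchyP => e e0.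
  (* The squared distance below is at most [4 * d]. *)
  pose d := e ^+ 2 / 5%:R.
  have d0 : 0 < d by rewrite divr_gt0 ?exprn_gt0.
  have [N hN] := approximant_eventually fB d0.
  exists (z N); exists N => // n /= Nn.
  rewrite -ball_normE /ball_ /= -(@ltr_pXn2r _ 2) ?nnegrE ?(ltW e0) //.
  rewrite -inner_norm -inner_formE.
  have := approximates_near (ltW d0) (ltW d0) (hN N (leqnn N)) (hN n Nn).
  move/le_lt_trans; apply.
  rewrite -mulr2n -mulrnA -mulr_natr /d mulrAC ltr_pdivrMr //.
  by rewrite ltr_pM2l ?exprn_gt0 // ltr_nat.
exists (lim (z n @[n --> \oo])) => v; set l := lim _.
have zv : ('[z n, v] : R[i]^o) @[n --> \oo] --> (f v : R[i]^o).
  pose b n : R[i]^o := '[v, v] * n.+1%:R^-1.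
  have b0 : b n @[n --> \oo] --> (0 : R[i]^o).
    by rewrite -(mulr0 '[v, v]); apply: cvg_complexZ; exact: cvg_complex_harmonic.
  have fz : forall n, `|f v - '[z n, v]| ^+ 2 <= b n.
    by move=> n; rewrite /b mulrC; exact: approximantP.
  apply: cvg_complex_eq (cvgB (cvg_cst (f v : R[i]^o)) (sqr_norm_cvg0 fz b0)) _ _.
    by move=> n /=; rewrite !fctE /=; ring.
  by rewrite subr0.
apply: (complex_limit_unique zv).
apply/cvgrPdist_lt => e e0.
have d0 : 0 < e / (`|v| + 1) by rewrite divr_gt0 // ltr_wpDl.
have /cvgrPdist_lt/(_ _ d0) := z_cvg; apply: filterS => n /ltW zn.
rewrite -linearBl /= (le_lt_trans (inner_CauchySchwarz _ _)) //.
apply: le_lt_trans (ler_wpM2r (normr_ge0 v) zn) _.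
by rewrite mulrAC ltr_pdivrMr ?ltr_wpDl // mulrDr mulr1 ltrDl.
Qed.

Definition norm_bounded G H (A : G -> H) : Prop :=
  exists c : R[i], 0 <= c /\ forall x, `|A x| <= c * `|x|.

Lemma linear_sub G H (A : G -> H) x y : linear A -> A (x - y) = A x - A y.
Proof. by move=> lA; rewrite addrC -scaleN1r lA scaleN1r addrC. Qed.

Lemma linear_map0 G H (A : G -> H) : linear A -> A 0 = 0.
Proof. by move=> lA; have := linear_sub 0 0 lA; rewrite !subrr. Qed.

Lemma norm_bounded_operator G H (A : G -> H) :
  linear A -> norm_bounded A -> bounded_operator A.
Proof.
move=> lA [c [c0 Ac]]; split=> // x; apply/cvgrPdist_lt => e e0.
have d0 : 0 < e / (c + 1) by rewrite divr_gt0 // ltr_wpDl.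
near=> y; rewrite -linear_sub // (le_lt_trans (Ac _)) //.
apply: (@le_lt_trans _ _ (c * (e / (c + 1)))).
  by rewrite ler_wpM2l // ltW //; near: y; exact: cvgr_dist_lt.
by rewrite mulrA mulrAC mulrC mulrA ltr_pdivrMr ?ltr_wpDl // mulrDr mulr1 ltrDl.
Unshelve. all: by end_near. Qed.

Lemma bounded_operator_norm G H (A : G -> H) :
  bounded_operator A -> norm_bounded A.
Proof.
move=> [lA cA].
pose A' : {linear G -> H} := HB.pack A (GRing.isLinear.Build _ _ _ _ A lA).
have /linear_bounded_continuous/linear_boundedP : continuous A' by [].
by move=> /pinfty_ex_gt0 [c c0 Ac]; exists c; split; [exact: ltW|].
Qed.

Lemma adjoint_exists G H (A : G -> H) : linear A -> norm_bounded A ->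
  exists A' : H -> G, forall x y, '[A x, y] = '[x, A' y].
Proof.
move=> lA [c [c0 Ac]].
have /choice[A' A'P] y : exists z, forall x, '[A x, y] = '[x, z].
  have [|z zP] := @riesz G (fun x => '[y, A x]).
    split=> [a u v|]; first by rewrite lA linearPr.
    exists ((`|y| * c) ^+ 2); split=> [|x]; first by rewrite exprn_ge0 ?mulr_ge0.
    rewrite inner_formE inner_norm -exprMn ler_pXn2r ?nnegrE ?mulr_ge0 //.
    by rewrite (le_trans (inner_CauchySchwarz _ _)) // -mulrA ler_wpM2l.
  by exists z => x; rewrite [RHS]inner_conj -zP -inner_conj.
by exists A'.
Qed.

Lemma adjoint_linear G H (A : G -> H) (A' : H -> G) :
  (forall x y, '[A x, y] = '[x, A' y]) -> linear A'.
Proof.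
by move=> AA' a u v; apply: inner_extr => x; rewrite -AA' !linearPr /= !AA'.
Qed.

(** [|A' y|^2 = <A (A' y), y>], and one factor [|A' y|] can be cancelled. *)
Lemma adjoint_bounded G H (A : G -> H) (A' : H -> G) :
  (forall x y, '[A x, y] = '[x, A' y]) -> norm_bounded A -> norm_bounded A'.
Proof.
move=> AA' [c [c0 Ac]]; exists c; split=> // y.
have [->|y0] := eqVneq (A' y) 0; first by rewrite normr0 mulr_ge0.
rewrite -(@ler_pM2l _ `|A' y|) ?normr_gt0 // -expr2 -inner_norm -AA'.
rewrite -[leLHS]ger0_norm ?AA' ?inner_ge0 // -AA'.
apply: le_trans (inner_CauchySchwarz _ _) _.
by rewrite mulrCA mulrA ler_wpM2r.
Qed.

End HilbertSpaces.

(** * Contractions acting on the completion *)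

Section Contractions.
Context {R : realType} {V : lmodType R[i]} (B : semi_inner V).

Record contraction := Contraction {
  contraction_fun :> V -> V;
  contraction_linear : linear contraction_fun;
  contraction_le : forall v, B (contraction_fun v) (contraction_fun v) <= B v v }.

Implicit Types (T : contraction) (x y : completion B).

Lemma pullback_bounded T x : bounded_functional B (x \o T).
Proof.
have [xlin [c [c0 xc]]] := completion_bounded x; split=> [a u v|] /=.
  by rewrite contraction_linear xlin.
exists c; split=> // v; apply: le_trans (xc _) _.
by rewrite ler_wpM2l // contraction_le.
Qed.

(** An operator on the completion given directly on functionals: it extends
    the adjoint of [T], when there is one ([pullback_embed]). *)
Definition pullback T x : completion B :=
  Completion (introT (asboolP _) (pullback_bounded T x)).

Lemma pullbackE T x v : pullback T x v = x (T v). Proof. by []. Qed.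

Lemma pullback_linear T : linear (pullback T).
Proof. by move=> a x y; apply: completion_ext. Qed.

Lemma pullback_norm T x : `|pullback T x| <= `|x|.
Proof.
apply: completion_norm_le => // v; rewrite pullbackE.
apply: le_trans (completion_eval_le _ _) _; rewrite ler_wpM2l //.
by rewrite ler_sqrtC ?nnegrE ?form_ge0 // contraction_le.
Qed.

Lemma pullback_bounded_operator T : bounded_operator (pullback T).
Proof.
apply: norm_bounded_operator; first exact: pullback_linear.
by exists 1; split=> // x; rewrite mul1r pullback_norm.
Qed.

(** [T'] maps almost representatives of [y] to almost representatives of
    [pullback T y]. *)
Lemma pullback_adjoint T T' : (forall u v, B (T u) v = B u (T' v)) ->
  forall x y, '[pullback T' x, y] = '[x, pullback T y].
Proof.
move=> TT' x y; rewrite !innerE.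
have xT : bounded_functional B (pullback T' x) := completion_bounded _.
apply: (complex_limit_unique (cvg_approximant xT (completion_bounded y))).
apply: (cvg_pairing (completion_bounded x) (completion_bounded _) _
  cvg_complex_harmonic) => n; first by rewrite invr_ge0.
move=> v; rewrite pullbackE form_conj -TT' -form_conj.
apply: le_trans (approximantP n (completion_bounded y) (T v)) _.
by rewrite ler_wpM2l ?invr_ge0 // contraction_le.
Qed.

Lemma pullback_embed T T' : (forall u v, B (T u) v = B u (T' v)) ->
  forall u, pullback T' (embed B u) = embed B (T u).
Proof. by move=> TT' u; apply: completion_ext => v; rewrite pullbackE /= TT'. Qed.

End Contractions.

(** * Isometric dilation of a column contraction *)

Section Dilation.
Context {R : realType} {d : nat} {G : hilbertType R} (L : 'I_d -> G -> G).
Hypothesis L_linear : forall i, linear (L i).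
Hypothesis L_contraction : forall g, \sum_i '[L i g, L i g] <= '[g, g].
Implicit Types (F E : word d -> G) (a b : word d) (i j : 'I_d) (n : nat).

Lemma column0 i : L i 0 = 0.
Proof. exact: linear_map0. Qed.

Definition branch i F : word d -> G := fun a => F (i :: a).
(** The adjoint of [branch i] for the form below; it becomes the isometry
    [S i]. *)
Definition graft i F : word d -> G :=
  fun a => if a is j :: b then (if j == i then F b else 0) else 0.
(** The function that represents [g] itself: its value at the word [i1 ... ik]
    is [L ik (... (L i1 g))]. *)
Definition trajectory (g : G) : word d -> G := foldl (fun h i => L i h) g.

Definition defect (g h : G) : R[i] := '[g, h] - \sum_i '[L i g, L i h].

(** If [S] dilates [L] and [x = g + \sum_i S_i x_i] with [g] in [G], then
    [S_i^* x = x_i + L_i g], and [|x|^2] is the defect of [g] plus the sum of the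
    [|S_i^* x|^2].  The form iterates this identity [n] times, [F a] being the
    component [g] of the vector [(S^a)^* x]; it defines the norm of [x] when
    this vector is in [G] for all [a] of length [n]. *)
Fixpoint tree_form n F E : R[i] :=
  if n is m.+1
  then defect (F [::]) (E [::]) + \sum_i tree_form m (branch i F) (branch i E)
  else '[F [::], E [::]].

(** A function which is determined by its values on words of length at most
    [n], the operators [L i] generating the others. *)
Definition driven_beyond n F : Prop :=
  forall a i, (n <= size a)%N -> F (rcons a i) = L i (F a).

Lemma driven_beyond_leq n m F : (n <= m)%N ->
  driven_beyond n F -> driven_beyond m F.
Proof. by move=> nm FL a i ma; apply: FL; exact: leq_trans ma. Qed.

Lemma driven_beyond_branch n F i : driven_beyond n.+1 F ->
  driven_beyond n (branch i F).
Proof. by move=> FL a j na; rewrite /branch -rcons_cons FL. Qed.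

(** Replacing the norm of a vector [g] by its defect and the norms of the
    [L i g] leaves the sum unchanged, so the truncation level does not matter
    beyond the level at which [L] takes over. *)
Lemma tree_form_stable n m F E : driven_beyond n F -> driven_beyond n E ->
  (n <= m)%N -> tree_form m F E = tree_form n F E.
Proof.
move=> FL EL /subnK <-; elim: (m - n)%N => [//|k IH].
rewrite addSn -{}IH; move: (driven_beyond_leq (leq_addl k n) FL)
  (driven_beyond_leq (leq_addl k n) EL).
move: (k + n)%N => l {FL EL}; elim: l F E => [|l IH] F E FL EL.
  rewrite /= /defect -[RHS]addr0 -addrA; congr (_ + _).
  rewrite addrC -sumrB big1 // => i _.
  by rewrite /branch (FL [::] i) // (EL [::] i) // subrr.
rewrite -[LHS]/(_ + _) -[RHS]/(_ + _); congr (_ + _).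
by apply: eq_bigr => i _; apply: IH; exact: driven_beyond_branch.
Qed.

Lemma defect_linear c (g h k : G) :
  defect (c *: g + h) k = c * defect g k + defect h k.
Proof.
rewrite /defect inner_linear.
under eq_bigr do rewrite L_linear inner_linear.
by rewrite big_split /= -mulr_sumr; ring.
Qed.

Lemma defect_conj (g h : G) : defect h g = (defect g h)^*%R.
Proof.
rewrite /defect rmorphB /= -inner_conj rmorph_sum /=; congr (_ - _).
by apply: eq_bigr => i _; rewrite -inner_conj.
Qed.

Lemma defect_ge0 g : 0 <= defect g g. Proof. by rewrite subr_ge0. Qed.

Lemma tree_form_linear n c F1 F2 E :
  tree_form n (c *: F1 + F2) E = c * tree_form n F1 E + tree_form n F2 E.
Proof.
elim: n F1 F2 E => [|n IH] F1 F2 E /=; first by rewrite inner_linear.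
rewrite defect_linear; under eq_bigr do rewrite IH.
by rewrite big_split /= -mulr_sumr; ring.
Qed.

Lemma tree_form_conj n F E : tree_form n E F = (tree_form n F E)^*%R.
Proof.
elim: n F E => [|n IH] F E /=; first by rewrite inner_conj.
rewrite rmorphD /= -defect_conj rmorph_sum /=; congr (_ + _).
by apply: eq_bigr => i _; rewrite IH.
Qed.

(** The defects are nonnegative because [L] is a column contraction. *)
Lemma tree_form_ge0 n F : 0 <= tree_form n F F.
Proof.
elim: n F => [|n IH] F /=; first exact: inner_ge0.
by rewrite addr_ge0 ?defect_ge0 ?sumr_ge0.
Qed.

(** Any level will do: these functions form a space that is stable under
    both [branch] and [graft]. *)
Definition driven_pred : {pred word d -> G} :=
  fun F => `[< exists n, driven_beyond n F >].

Lemma driven_beyond_linear n c F E : driven_beyond n F -> driven_beyond n E ->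
  driven_beyond n (c *: F + E).
Proof.
move=> FL EL a i na; rewrite -[LHS]/(c *: F (rcons a i) + E (rcons a i)).
by rewrite FL // EL // -L_linear.
Qed.

Lemma driven_submod_closed : submod_closed driven_pred.
Proof.
split=> [|c F E /asboolP[n FL] /asboolP[m EL]]; apply/asboolP.
  by exists 0%N => a i _; rewrite -[RHS]/(L i 0) column0.
exists (maxn n m); apply: driven_beyond_linear.
- exact: driven_beyond_leq (leq_maxl _ _) FL.
- exact: driven_beyond_leq (leq_maxr _ _) EL.
Qed.

HB.instance Definition _ :=
  GRing.isSubmodClosed.Build _ _ driven_pred driven_submod_closed.

Record driven := Driven {
  driven_fun :> word d -> G ; drivenP : driven_fun \in driven_pred }.

HB.instance Definition _ := [isSub for driven_fun].
HB.instance Definition _ := [Choice of driven by <:].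
HB.instance Definition _ := [SubChoice_isSubLmodule of driven by <:].

Implicit Types (f e : driven).

Lemma driven_ext f e : (forall a, f a = e a) -> f = e.
Proof. by move=> fe; apply/val_inj/funext. Qed.

Lemma driven_degree f : exists n, driven_beyond n f.
Proof. exact/asboolP/drivenP. Qed.

Definition degree f : nat := projT1 (cid (driven_degree f)).

Lemma degreeP f : driven_beyond (degree f) f.
Proof. exact: projT2 (cid (driven_degree f)). Qed.
Arguments degreeP : clear implicits.

(** The form at any level from which both functions are driven, see
    [driven_innerE]. *)
Definition driven_inner f e : R[i] := tree_form (maxn (degree f) (degree e)) f e.

Lemma driven_innerE n f e : driven_beyond n f -> driven_beyond n e ->
  driven_inner f e = tree_form n f e.
Proof.
move=> fn en; pose k := maxn (degree f) (degree e).
have [fk ek] : driven_beyond k f /\ driven_beyond k e.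
  by split; [apply: driven_beyond_leq (degreeP f); exact: leq_maxl
            |apply: driven_beyond_leq (degreeP e); exact: leq_maxr].
rewrite /driven_inner -/k -(tree_form_stable fk ek (leq_maxl k n)).
by rewrite -(tree_form_stable fn en (leq_maxr k n)).
Qed.

(** A single level for finitely many functions, so that identities between
    inner products can be checked on [tree_form]. *)
Lemma driven_beyond_common (s : seq driven) :
  exists n, forall f, f \in s -> driven_beyond n f.
Proof.
exists (\max_(f <- s) degree f)%N => f fs.
by apply: driven_beyond_leq (degreeP f); rewrite (big_rem f) //= leq_maxl.
Qed.

Fact driven_inner_linear c f1 f2 e :
  driven_inner (c *: f1 + f2) e = c * driven_inner f1 e + driven_inner f2 e.
Proof.
have [n h] := driven_beyond_common [:: f1; f2; e].
have f1n : driven_beyond n f1 by apply: h; rewrite inE eqxx.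
have f2n : driven_beyond n f2 by apply: h; rewrite !inE eqxx orbT.
have en : driven_beyond n e by apply: h; rewrite !inE eqxx !orbT.
rewrite !(@driven_innerE n) //; first exact: tree_form_linear.
exact: driven_beyond_linear.
Qed.

Fact driven_inner_conj f e : driven_inner e f = (driven_inner f e)^*%R.
Proof. by rewrite /driven_inner maxnC tree_form_conj. Qed.

Fact driven_inner_ge0 f : 0 <= driven_inner f f.
Proof. exact: tree_form_ge0. Qed.

Definition driven_form :=
  SemiInner driven_inner_linear driven_inner_conj driven_inner_ge0.

Lemma driven_beyond_graft n F i : driven_beyond n F ->
  driven_beyond n.+1 (graft i F).
Proof.
move=> FL [//|j a] k /= na; case: eqP => _; first exact: FL.
by rewrite column0.
Qed.

Lemma branch_driven i f : branch i f \in driven_pred.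
Proof.
apply/asboolP; exists (degree f); apply: driven_beyond_branch.
exact: driven_beyond_leq (leqnSn _) (degreeP f).
Qed.

Lemma graft_driven i f : graft i f \in driven_pred.
Proof. apply/asboolP; exists (degree f).+1; exact/driven_beyond_graft/degreeP. Qed.

Lemma trajectory_driven g : trajectory g \in driven_pred.
Proof. by apply/asboolP; exists 0%N => a i _; rewrite /trajectory foldl_rcons. Qed.

Definition driven_branch i f := Driven (branch_driven i f).
Definition driven_graft i f := Driven (graft_driven i f).
Definition driven_of g := Driven (trajectory_driven g).

Lemma driven_branch_graft i j f :
  driven_branch i (driven_graft j f) = (i == j)%:R *: f.
Proof.
apply: driven_ext => a; rewrite -[RHS]/((i == j)%:R *: f a).
by rewrite /= /branch /=; case: eqP => _; rewrite ?scale1r ?scale0r.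
Qed.

Lemma driven_branch_linear i : linear (driven_branch i).
Proof. by move=> c f e; apply: driven_ext. Qed.

Lemma driven_graft_linear i : linear (driven_graft i).
Proof.
move=> c f e; apply: driven_ext => -[|j a].
  by rewrite -[RHS]/(c *: 0 + 0) scaler0 addr0.
rewrite -[RHS]/(c *: graft i f (j :: a) + graft i e (j :: a)) /=.
by case: eqP => // _; rewrite scaler0 addr0.
Qed.

Lemma driven_form_step n f e : driven_beyond n.+1 f -> driven_beyond n.+1 e ->
  driven_form f e =
  defect (f [::]) (e [::]) +
  \sum_i driven_form (driven_branch i f) (driven_branch i e).
Proof.
move=> fn en; rewrite /= (driven_innerE fn en) /=; congr (_ + _).
apply: eq_bigr => i _; rewrite (@driven_innerE n) //;
  exact: driven_beyond_branch.
Qed.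

(** Both operators below are understood from this unfolding at the root. *)
Lemma driven_formE f e : driven_form f e =
  defect (f [::]) (e [::]) +
  \sum_i driven_form (driven_branch i f) (driven_branch i e).
Proof.
apply: (@driven_form_step (maxn (degree f) (degree e))).
- by apply: driven_beyond_leq (degreeP f); rewrite leqW // leq_maxl.
- by apply: driven_beyond_leq (degreeP e); rewrite leqW // leq_maxr.
Qed.

(** The root and all branches but one of a graft vanish. *)
Lemma driven_graft_adjoint i f e :
  driven_form (driven_graft i f) e = driven_form f (driven_branch i e).
Proof.
rewrite driven_formE (bigD1 i) //= big1 => [|j ji].
  rewrite addr0 driven_branch_graft eqxx scale1r /defect /= linear0l.
  rewrite big1 ?subr0 ?add0r //.
  by move=> j _; rewrite column0 linear0l.
by rewrite driven_branch_graft (negPf ji) scale0r; exact: (form0l driven_form).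
Qed.

Lemma driven_branch_adjoint i f e :
  driven_form (driven_branch i f) e = driven_form f (driven_graft i e).
Proof. by rewrite (form_conj driven_form) -driven_graft_adjoint -form_conj. Qed.

Lemma driven_graft_le i f :
  driven_form (driven_graft i f) (driven_graft i f) <= driven_form f f.
Proof. by rewrite driven_graft_adjoint driven_branch_graft eqxx scale1r. Qed.

(** The unfolding of the form of [f] at the root contains the form of the
    branch, along with nonnegative terms. *)
Lemma driven_branch_le i f :
  driven_form (driven_branch i f) (driven_branch i f) <= driven_form f f.
Proof.
rewrite [leRHS]driven_formE (bigD1 i) //= addrCA lerDl addr_ge0 ?defect_ge0 //.
by rewrite sumr_ge0 // => j _; exact: driven_inner_ge0.
Qed.

Definition branch_contraction i :=
  Contraction (driven_branch_linear i) (driven_branch_le i).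
Definition graft_contraction i :=
  Contraction (driven_graft_linear i) (driven_graft_le i).

Lemma driven_of_linear : linear driven_of.
Proof.
move=> c g h; apply: driven_ext => a.
rewrite -[RHS]/(c *: trajectory g a + trajectory h a) /= /trajectory.
by elim: a g h => [//|i a IH] g h /=; rewrite L_linear IH.
Qed.

(** A trajectory is driven from the root on, so its form is the norm there. *)
Lemma driven_of_inner g h : driven_form (driven_of g) (driven_of h) = '[g, h].
Proof.
rewrite /= (@driven_innerE 0%N) //.
- by move=> a i _; rewrite /= /trajectory foldl_rcons.
- by move=> a i _; rewrite /= /trajectory foldl_rcons.
Qed.

Lemma driven_branch_of i g : driven_branch i (driven_of g) = driven_of (L i g).
Proof. exact: driven_ext. Qed.

(** [S i] and [T i] extend [graft i] and [branch i].  Grafts on different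
    letters have no branch in common, whence the orthogonality of the ranges;
    the branch of the trajectory of [g] is the trajectory of [L i g], so [T i]
    extends [L i]. *)
Theorem isometric_dilation :
  exists (KK : hilbertType R) (S T : 'I_d -> KK -> KK) (J : G -> KK),
  [/\ forall i, bounded_operator (S i),
      forall i x y, '[S i x, y] = '[x, T i y],
      forall i j x, T i (S j x) = (i == j)%:R *: x,
      linear J /\ (forall g h, '[J g, J h] = '[g, h])
    & forall i g, T i (J g) = J (L i g)].
Proof.
exists (completion driven_form : hilbertType R).
exists (fun i => pullback (branch_contraction i)).
exists (fun i => pullback (graft_contraction i)).
exists (fun g => embed driven_form (driven_of g)); split.
- by move=> i; exact: pullback_bounded_operator.
- by move=> i x y; apply: pullback_adjoint => f e; exact: driven_graft_adjoint.
- move=> i j x; apply: completion_ext => f; rewrite !pullbackE /=.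
  rewrite driven_branch_graft eq_sym -[RHS]/((i == j)%:R * x f).
  case: eqP => _; first by rewrite scale1r mul1r.
  rewrite scale0r mul0r -(subrr 0) (functionalB _ _ (completion_bounded x)).
  by rewrite subrr.
- split=> [c g h|g h]; first by rewrite driven_of_linear embed_linear.
  by rewrite inner_embed2 driven_of_inner.
- move=> i g; rewrite -driven_branch_of.
  apply: (@pullback_embed _ _ _ (branch_contraction i) (graft_contraction i)).
  by move=> f e; exact: driven_branch_adjoint.
Qed.

End Dilation.

(** * Extension of column contractions *)

Section ColumnExtension.
Context {R : realType}.

(** The inner product of a finite direct sum. *)
Definition column_inner {G : hilbertType R} {I : finType} (x y : I -> G) : R[i] :=
  \sum_i '[x i, y i].

Section ColumnForm.
Context (G : hilbertType R) (I : finType).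
Implicit Types x y z : I -> G.

Fact column_inner_linear a x y z :
  column_inner (a *: x + y) z = a * column_inner x z + column_inner y z.
Proof.
rewrite /column_inner mulr_sumr -big_split; apply: eq_bigr => i _.
exact: inner_linear.
Qed.

Fact column_inner_conj x y : column_inner y x = (column_inner x y)^*%R.
Proof.
by rewrite /column_inner rmorph_sum; apply: eq_bigr => i _; exact: inner_conj.
Qed.

Fact column_inner_ge0 x : 0 <= column_inner x x.
Proof. by apply: sumr_ge0 => i _; exact: inner_ge0. Qed.

Definition column_form : semi_inner (I -> G) :=
  SemiInner column_inner_linear column_inner_conj column_inner_ge0.

End ColumnForm.

(** Instead of extending the column [l] by continuity, its adjoint row is
    defined: [row y] is the functional [u |-> \sum_i <y i, l i u>], which is
    bounded by Cauchy-Schwarz in the direct sum, so the row is a contraction.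
    The [L i] are the adjoints of its entries, and a column is as contractive
    as its adjoint row. *)
Lemma extend_column_contraction (V : lmodType R[i]) (B : semi_inner V)
    (G : hilbertType R) (I : finType) (l : I -> V -> G) :
  (forall i, linear (l i)) -> (forall u, \sum_i '[l i u, l i u] <= B u u) ->
  exists L : I -> completion B -> G,
    [/\ forall i, linear (L i), forall i u, L i (embed B u) = l i u
      & forall x, \sum_i '[L i x, L i x] <= '[x, x]].
Proof.
move=> llin lB.
have rowP (y : I -> G) :
    functional_bound B (fun u => column_inner y (l^~ u)) (column_inner y y) /\
    bounded_functional B (fun u => column_inner y (l^~ u)).
  have yB : functional_bound B (fun u => column_inner y (l^~ u)) (column_inner y y).
    split=> [|u]; first exact: column_inner_ge0.
    apply: le_trans (form_CauchySchwarz (column_form G I) y (l^~ u)) _.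
    by apply: ler_wpM2l; [exact: column_inner_ge0|exact: lB].
  split=> //; split=> [a u v|]; last by exists (column_inner y y).
  rewrite /column_inner mulr_sumr -big_split; apply: eq_bigr => i _ /=.
  by rewrite llin linearPr.
pose row y : completion B := Completion (introT (asboolP _) (rowP y).2).
have row_le y : '[row y, row y] <= column_inner y y.
  exact: pairing_le (completion_bounded (row y)) (rowP y).1.
pose single i (z : G) : I -> G := fun j => if j == i then z else 0.
have row_single i z u : row (single i z) u = '[z, l i u].
  rewrite /= /column_inner (bigD1 i) //= big1 /single ?eqxx ?addr0 //.
  move=> j /negPf ->.
  exact: linear0l.
have Tlin i : linear (fun z => row (single i z)).
  move=> a z w; apply: completion_ext => u.
  by rewrite completionDE completionZE !row_single inner_linear.
have Tbd i : norm_bounded (fun z => row (single i z)).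
  exists 1; split=> // z; rewrite mul1r -(@ler_pXn2r _ 2) ?nnegrE // -!inner_norm.
  apply: le_trans (row_le _) _.
  rewrite /column_inner (bigD1 i) //= big1 /single ?eqxx ?addr0 //.
  move=> j /negPf ->.
  exact: linear0l.
have /choice[L LP] i := adjoint_exists (Tlin i) (Tbd i).
have Llin i : linear (L i) := adjoint_linear (LP i).
exists L; split=> // [i u|x].
  apply: inner_extr => z; rewrite -LP inner_embed; exact: row_single.
set s := \sum_i _.
have s0 : 0 <= s := column_inner_ge0 (L^~ x).
pose y := row (L^~ x).
have ys : '[y, x] = s.
  have -> : y = \sum_i row (single i (L i x)).
    apply: completion_ext => u.
    have evalD (F : I -> completion B) : (\sum_i F i) u = \sum_i F i u.
      by apply: (big_morph (fun z : completion B => z u)).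
    by rewrite evalD; apply: eq_bigr => i _; rewrite row_single.
  by rewrite linear_sumlz; apply: eq_bigr => i _; exact: LP.
have yy : '[y, y] <= s := row_le (L^~ x).
have : `|'[y, x]| ^+ 2 <= s * '[x, x].
  apply: le_trans (form_CauchySchwarz (inner_form _) y x) _.
  by apply: ler_wpM2r; [exact: inner_ge0|exact: yy].
rewrite ys (ger0_norm s0).
have [->|sN0] := eqVneq s 0; first by rewrite inner_ge0.
by rewrite expr2 ler_pM2l // lt_def sN0.
Qed.

End ColumnExtension.

(** * The finite model of a kernel *)

(** Polarisation: for a complex space, a form with real values on the diagonal
    is hermitian; the form of a positive definite kernel is of this kind. *)
Lemma sesquilinear_hermitian {R : realType} {V : lmodType R[i]}
    (Q : V -> V -> R[i]) :
  (forall a u v w, Q (a *: u + v) w = a * Q u w + Q v w) ->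
  (forall a u v w, Q w (a *: u + v) = a^*%R * Q w u + Q w v) ->
  (forall u, 0 <= Q u u) -> forall u v, Q v u = (Q u v)^*%R.
Proof.
move=> Ql Qr Q0 u v.
have Qreal w : (Q w w)^*%R = Q w w by apply: conj_Creal; exact: ger0_real.
have E a : a * Q u v + a^*%R * Q v u = (a * Q u v + a^*%R * Q v u)^*%R.
  have : Q (a *: u + v) (a *: u + v) - (a * a^*%R) * Q u u - Q v v =
         a * Q u v + a^*%R * Q v u.
    by rewrite Ql !Qr; ring.
  by move=> <-; rewrite !rmorphB !rmorphM /= !Qreal conjCK [a^*%R * a]mulrC.
(* The values 1 and i of [a] give the real and imaginary parts. *)
set s := Q u v in E *; set t := Q v u in E *.
have E1 : s + t = s^*%R + t^*%R by have := E 1; rewrite rmorph1 !mul1r rmorphD.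
have Ei : s - t = t^*%R - s^*%R.
  apply: (mulfI (neq0Ci R[i])).
  have := E 'i%R; rewrite rmorphD !rmorphM /= conjCK !conjCi => H.
  have -> : 'i%R * (s - t) = 'i%R * s + - 'i%R * t by ring.
  by rewrite H; ring.
have : s *+ 2 = t^*%R *+ 2.
  have -> : s *+ 2 = (s + t) + (s - t) by ring.
  by rewrite E1 Ei; ring.
by move=> /eqP; rewrite eqrMn2r /= => /eqP ->; rewrite conjCK.
Qed.

(** Positive definiteness is stated for families indexed by ordinals. *)
Lemma sum_enum {R : realType} {I : finType} (F : I -> R[i]) :
  \sum_x F x = \sum_(j < #|I|) F (enum_val j).
Proof.
by rewrite (reindex (@enum_val I I)) //; apply: onW_bij; exact: enum_val_bij.
Qed.

Section KernelModel.
Context {R : realType} {d N : nat} {H : hilbertType R} (K : kernel d H).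
Hypothesis Kop : operator_valued (Lambda d N) K.
Hypothesis Kpd : positive_definite (Lambda d N) K.

Lemma kernel0 a b : (size a <= N)%N -> (size b <= N)%N -> K a b 0 = 0.
Proof. by move=> aN bN; exact: linear_map0 (Kop aN bN).1. Qed.

Section KernelForm.
Context {I : finType} (w : I -> word d).
Hypothesis wN : forall x, (size (w x) <= N)%N.
Implicit Types f g h : I -> H.

(** The words are indexed by an arbitrary finite type because two families
    are compared below: all words up to some length, and the same family next
    to its shift by a letter. *)
Definition kernel_inner f g : R[i] := \sum_x \sum_y '[f x, K (w x) (w y) (g y)].

Fact kernel_inner_linear a f g h :
  kernel_inner (a *: f + g) h = a * kernel_inner f h + kernel_inner g h.
Proof.
rewrite /kernel_inner mulr_sumr -big_split; apply: eq_bigr => x _ /=.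
rewrite mulr_sumr -big_split; apply: eq_bigr => y _ /=; exact: inner_linear.
Qed.

Fact kernel_inner_conjlinear a f g h :
  kernel_inner h (a *: f + g) = a^*%R * kernel_inner h f + kernel_inner h g.
Proof.
rewrite /kernel_inner mulr_sumr -big_split; apply: eq_bigr => x _ /=.
rewrite mulr_sumr -big_split; apply: eq_bigr => y _ /=.
by rewrite -[(_ + _) y]/(a *: f y + g y) (Kop (wN x) (wN y)).1 linearPr.
Qed.

Fact kernel_inner_ge0 f : 0 <= kernel_inner f f.
Proof.
have := @Kpd #|I| (w \o enum_val) (f \o enum_val) (fun j => wN (enum_val j)).
move/le_trans; apply; rewrite /kernel_inner [leRHS]sum_enum; apply/eqW.
by apply: eq_bigr => j _; rewrite [RHS]sum_enum.
Qed.

Definition kernel_form : semi_inner (I -> H) := SemiInner kernel_inner_linear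
  (sesquilinear_hermitian
     kernel_inner_linear kernel_inner_conjlinear kernel_inner_ge0)
  kernel_inner_ge0.

End KernelForm.

Section FiniteModel.
Variable M : nat.
Hypothesis MN : (M < N)%N.
Hypothesis Kle : kernel_le (Lambda d M) (shifted K) K.
Implicit Types (i : 'I_d) (a b : word d) (u v : H).

Local Notation index := (M.-bseq 'I_d).
Implicit Types (x y : index) (f g h : index -> H).

Definition index_word x : word d := x.

Lemma index_wordN x : (size (index_word x) <= N)%N.
Proof. exact: leq_trans (size_bseq x) (ltnW MN). Qed.

Definition model_form := kernel_form index_wordN.

(** The words [x i] with a last letter added, next to the words [x]: the form
    on this family compares [K] with its shift. *)
Definition mixed_word i (s : index + index) : word d :=
  match s with inl x => rcons x i | inr x => x end.

Lemma mixed_wordN i s : (size (mixed_word i s) <= N)%N.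
Proof.
case: s => x /=; last exact: index_wordN.
by rewrite size_rcons; apply: leq_ltn_trans (size_bseq x) MN.
Qed.

Definition mixed_form i := kernel_form (mixed_wordN i).

Definition in_shifted f (s : index + index) : H := if s is inl x then f x else 0.
Definition in_plain f (s : index + index) : H := if s is inr x then f x else 0.

Lemma mixed_form_sp i f g : mixed_form i (in_shifted f) (in_plain g) =
  \sum_(x : index) \sum_(y : index) '[f x, K (rcons x i) y (g y)].
Proof.
rewrite /= /kernel_inner big_sumType /= addrC big1 ?add0r => [|x _]; last first.
  by rewrite big1 // => s _; exact: linear0l.
apply: eq_bigr => x _; rewrite big_sumType /= big1 ?add0r // => y _.
by rewrite kernel0 ?linear0r //; exact: (mixed_wordN i (inl _)).
Qed.

Lemma mixed_form_ss i f : mixed_form i (in_shifted f) (in_shifted f) =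
  \sum_(x : index) \sum_(y : index) '[f x, K (rcons x i) (rcons y i) (f y)].
Proof.
rewrite /= /kernel_inner big_sumType /= addrC big1 ?add0r => [|x _]; last first.
  by rewrite big1 // => s _; exact: linear0l.
apply: eq_bigr => x _; rewrite big_sumType /= addrC big1 ?add0r // => y _.
rewrite kernel0 ?linear0r //; first exact: (mixed_wordN i (inl _)).
exact: index_wordN.
Qed.

Lemma mixed_form_pp i f : mixed_form i (in_plain f) (in_plain f) = model_form f f.
Proof.
rewrite /= /kernel_inner big_sumType /= big1 ?add0r => [|x _]; last first.
  by rewrite big1 // => s _; exact: linear0l.
apply: eq_bigr => x _; rewrite big_sumType /= big1 ?add0r // => y _.
rewrite kernel0 ?linear0r //; first exact: index_wordN.
exact: (mixed_wordN i (inl _)).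
Qed.

(** The inequality between [K] and its shift, for the family of all words of
    length at most [M]. *)
Lemma shifted_form_le f :
  \sum_i mixed_form i (in_shifted f) (in_shifted f) <= model_form f f.
Proof.
rewrite -subr_ge0.
have := @Kle #|{: index}| (@index_word \o enum_val) (f \o enum_val)
  (fun j => size_bseq (enum_val j)).
move/le_trans; apply; apply/eqW.
under [X in _ = _ - X]eq_bigr do rewrite mixed_form_ss.
rewrite /= /kernel_inner [X in _ = _ - X]exchange_big /= -sumrB [RHS]sum_enum.
apply: eq_bigr => j _.
rewrite [X in _ = _ - X]exchange_big /= -sumrB [RHS]sum_enum.
apply: eq_bigr => k _.
by rewrite linearBr /= linear_sumr.
Qed.

(** Cauchy-Schwarz for the form on the mixed family. *)
Lemma shift_bound i f : functional_bound model_form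
  (fun g => \sum_(x : index) \sum_(y : index) '[f x, K (rcons x i) y (g y)])
  (mixed_form i (in_shifted f) (in_shifted f)).
Proof.
split=> [|g]; first exact: (form_ge0 (mixed_form i)).
rewrite -mixed_form_sp -(mixed_form_pp i).
exact: (form_CauchySchwarz (mixed_form i)).
Qed.

Lemma shift_functional i f : bounded_functional model_form
  (fun g => \sum_(x : index) \sum_(y : index) '[f x, K (rcons x i) y (g y)]).
Proof.
split; last by eexists; exact: shift_bound.
move=> a g h; rewrite mulr_sumr -big_split; apply: eq_bigr => x _ /=.
rewrite mulr_sumr -big_split; apply: eq_bigr => y _ /=.
rewrite -[(_ + _) y]/(a *: g y + h y) (Kop _ _).1 ?linearPr //.
- exact: (mixed_wordN i (inl x)).
- exact: index_wordN.
Qed.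

(** The vector [\sum_x V_(x i) (f x)], compressed to the completion: only its
    inner products with the vectors [V_y] for [y] of length at most [M] enter.
    These involve [K] on words of length [M + 1]. *)
Definition shift i f : completion model_form :=
  Completion (introT (asboolP _) (shift_functional i f)).

Lemma shift_linear i : linear (shift i).
Proof.
move=> c f g; apply: completion_ext => h; rewrite completionDE completionZE /=.
rewrite mulr_sumr -big_split; apply: eq_bigr => x _ /=.
rewrite mulr_sumr -big_split; apply: eq_bigr => y _ /=; exact: inner_linear.
Qed.

Lemma shift_contraction f : \sum_i '[shift i f, shift i f] <= model_form f f.
Proof.
apply: le_trans (shifted_form_le f); apply: ler_sum => i _.
exact: pairing_le (completion_bounded (shift i f)) (shift_bound i f).
Qed.

Definition delta a u : index -> H := fun x => if index_word x == a then u else 0.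

Lemma delta_linear a : linear (delta a).
Proof.
move=> c u v; apply/funext => x.
rewrite -[RHS]/(c *: delta a u x + delta a v x) /delta.
by case: eqP => // _; rewrite scaler0 addr0.
Qed.

Lemma sum_delta a u (F : word d -> H) : (size a <= M)%N ->
  \sum_(x : index) '[delta a u x, F x] = '[u, F a].
Proof.
move=> aM; rewrite (bigD1 (Bseq aM)) //= {1}/delta eqxx big1 ?addr0 // => x xa.
by rewrite /delta ifN ?linear0l.
Qed.

Lemma sum_delta_kernel a b u v : (size a <= N)%N -> (size b <= M)%N ->
  \sum_(x : index) '[u, K a x (delta b v x)] = '[u, K a b v].
Proof.
move=> aN bM; rewrite (bigD1 (Bseq bM)) //= {1}/delta eqxx big1 ?addr0 // => x xb.
by rewrite /delta ifN ?kernel0 ?linear0r //; exact: index_wordN.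
Qed.

Lemma exchange_delta a u f (F : word d -> word d -> H -> H) : (size a <= M)%N ->
  \sum_(x : index) \sum_(y : index) '[delta a u x, F x y (f y)] =
  \sum_(y : index) '[u, F a y (f y)].
Proof.
move=> aM; rewrite exchange_big; apply: eq_bigr => y _.
exact: (sum_delta _ (F ^~ y ^~ (f y))).
Qed.

Lemma model_delta a b u v : (size a <= M)%N -> (size b <= M)%N ->
  model_form (delta a u) (delta b v) = '[u, K a b v].
Proof.
move=> aM bM; rewrite /= /kernel_inner (exchange_delta _ _ K) //.
by rewrite sum_delta_kernel // (leq_trans aM (ltnW MN)).
Qed.

Lemma shift_delta a i u : (size a < M)%N ->
  shift i (delta a u) = embed model_form (delta (rcons a i) u).
Proof.
move=> aM; apply: completion_ext => f /=.
rewrite (exchange_delta _ _ (fun x : word d => K (rcons x i))) ?(ltnW aM) //.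
by rewrite /kernel_inner (exchange_delta _ _ K) // size_rcons.
Qed.

(** [V a u] is the function supported at [a], with value [u].  The columns
    [shift] are contractive by [shifted_form_le], hence extend to the completion;
    for a word [a] shorter than [M], compressing [V_(a i) u] does nothing. *)
Theorem finite_model :
  exists (G : hilbertType R) (L : 'I_d -> G -> G) (V : word d -> H -> G),
  [/\ forall i, linear (L i),
      forall g : G, \sum_i '[L i g, L i g] <= '[g, g],
      linear (V [::]),
      forall a b u v, (size a <= M)%N -> (size b <= M)%N ->
        '[V a u, V b v] = '[u, K a b v]
    & forall a i u, (size a < M)%N -> L i (V a u) = V (rcons a i) u].
Proof.
have [L [Llin Lemb Lcontr]] :=
  extend_column_contraction shift_linear shift_contraction.
exists (completion model_form : hilbertType R), L.
exists (fun a u => embed model_form (delta a u)).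
split=> //.
- by move=> c u v; rewrite delta_linear embed_linear.
- by move=> a b u v aM bM; rewrite inner_embed2 model_delta.
- by move=> a i u aM; rewrite Lemb shift_delta.
Qed.

End FiniteModel.
End KernelModel.

(** * Kernels of row isometries *)

Section RowIsometryKernel.
Context {R : realType} {d : nat} {H KK : hilbertType R}.
Context (S T : 'I_d -> KK -> KK) (W : H -> KK) (Wt : KK -> H).
Hypothesis S_bounded : forall i, bounded_operator (S i).
Hypothesis S_adjoint : forall i x y, '[S i x, y] = '[x, T i y].
Hypothesis S_row : forall i j x, T i (S j x) = (i == j)%:R *: x.
Hypothesis W_linear : linear W.
Hypothesis W_bounded : norm_bounded W.
Hypothesis W_adjoint : forall u y, '[W u, y] = '[u, Wt y].
Implicit Types (a b : word d) (u v : H) (x y : KK).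

(** The first letter acts first: [(S_i1 ... S_ik)^* = T_ik ... T_i1]. *)
Definition word_adj a x : KK := foldl (fun y i => T i y) x a.

Lemma word_op_adjoint a x y : '[word_op S a x, y] = '[x, word_adj a y].
Proof. by elim: a y => [//|i a IH] y; rewrite /= S_adjoint IH. Qed.

Lemma row_isometryP : row_isometry S.
Proof. by split=> // i j x; rewrite (adjointP (S_adjoint i)) S_row. Qed.

Lemma word_op_bounded a : linear (word_op S a) /\ norm_bounded (word_op S a).
Proof.
elim: a => [|i a [lin [c [c0 bd]]]].
  by split=> //; exists 1; split=> // x; rewrite mul1r.
have [Slin _] := S_bounded i.
have [e [e0 ebd]] := bounded_operator_norm (S_bounded i).
split=> [k x y|]; first by rewrite /= lin Slin.
exists (e * c); split=> [|x]; first exact: mulr_ge0.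
by rewrite /= (le_trans (ebd _)) // -mulrA ler_wpM2l.
Qed.

(** The identity is the orthogonal projection of the representation. *)
Definition row_kernel : kernel d H :=
  fun a b => adjoint W \o word_op S a \o id \o adjoint (word_op S b) \o W.

Lemma row_kernelE a b u : row_kernel a b u = Wt (word_op S a (word_adj b (W u))).
Proof.
by rewrite /row_kernel /= (adjointP W_adjoint) (adjointP (word_op_adjoint b)).
Qed.

Lemma inner_row_kernel a b u v :
  '[u, row_kernel a b v] = '[word_adj a (W u), word_adj b (W v)].
Proof.
rewrite row_kernelE -W_adjoint inner_conj word_op_adjoint.
by rewrite -inner_conj.
Qed.

Lemma row_kernel_operator a b : bounded_operator (row_kernel a b).
Proof.
have [Slin [c [c0 Sbd]]] := word_op_bounded a.
have [_ /(adjoint_bounded (word_op_adjoint b)) [e [e0 Abd]]] := word_op_bounded b.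
have Alin := adjoint_linear (word_op_adjoint b).
have Wtlin := adjoint_linear W_adjoint.
have [k [k0 Wbd]] := W_bounded.
have [l [l0 Wtbd]] := adjoint_bounded W_adjoint W_bounded.
apply: norm_bounded_operator.
  by move=> s u v; rewrite !row_kernelE W_linear Alin Slin Wtlin.
exists (l * (c * (e * k))); split=> [|u]; first by rewrite !mulr_ge0.
rewrite row_kernelE (le_trans (Wtbd _)) // -mulrA ler_wpM2l //.
rewrite (le_trans (Sbd _)) // -mulrA ler_wpM2l //.
by rewrite (le_trans (Abd _)) // -mulrA ler_wpM2l.
Qed.

Lemma row_kernel_sum m (a : 'I_m -> word d) (u : 'I_m -> H) :
  \sum_(j < m) \sum_(k < m) '[u j, row_kernel (a j) (a k) (u k)] =
  '[\sum_j word_adj (a j) (W (u j)), \sum_j word_adj (a j) (W (u j))].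
Proof.
rewrite linear_sumlz; apply: eq_bigr => j _; rewrite linear_sumr.
by apply: eq_bigr => k _; rewrite inner_row_kernel.
Qed.

Lemma row_kernel_positive : positive_definite setT row_kernel.
Proof. by move=> m a u _; rewrite row_kernel_sum inner_ge0. Qed.

(** [y = \sum_i S_i S_i^* x] is the orthogonal projection of [x] on the span of
    the ranges: [<y, x> = <y, y>] is the sum on the left, and
    [|x - y|^2 >= 0]. *)
Lemma row_isometry_bessel x : \sum_i '[T i x, T i x] <= '[x, x].
Proof.
set s := \sum_i _; pose y := \sum_i S i (T i x).
have yx : '[y, x] = s.
  by rewrite linear_sumlz; apply: eq_bigr => i _; exact: S_adjoint.
have sr : s^*%R = s := esym (column_inner_conj (T^~ x) (T^~ x)).
have yy : '[y, y] = s.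
  rewrite {1}/y linear_sumlz; apply: eq_bigr => i _.
  rewrite /y linear_sumr (bigD1 i) //= big1 => [|j ji].
    by rewrite addr0 S_adjoint S_row eqxx scale1r.
  by rewrite S_adjoint S_row eq_sym (negPf ji) scale0r linear0r.
have := inner_ge0 (x - y).
rewrite linearBl !linearBr /= yx yy [X in X - _ - _]/('[x, x]).
by rewrite [X in _ - X - _]inner_conj yx sr subrr subr0 subr_ge0.
Qed.

(** Appending the letter [i] to all words applies [T i] to the vector whose
    square norm is the quadratic form of the kernel ([row_kernel_sum]), so the
    claim is Bessel's inequality for this vector. *)
Lemma row_kernel_shifted : kernel_le setT (shifted row_kernel) row_kernel.
Proof.
move=> m a u _.
pose x := \sum_j word_adj (a j) (W (u j)).
have Tx i : \sum_j word_adj (rcons (a j) i) (W (u j)) = T i x.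
  have Tlin := adjoint_linear (S_adjoint i).
  rewrite /x (big_morph (T i) (id1 := 0) (op1 := +%R)).
  - by apply: eq_bigr => j _; rewrite /word_adj foldl_rcons.
  - by move=> y z; rewrite -[y]scale1r Tlin !scale1r.
  - exact: linear_map0.
suff -> : \sum_(j < m) \sum_(k < m) '[u j, row_kernel (a j) (a k) (u k) -
    shifted row_kernel (a j) (a k) (u k)] = '[x, x] - \sum_i '[T i x, T i x].
  by rewrite subr_ge0 row_isometry_bessel.
rewrite -row_kernel_sum.
under [X in _ = _ - X]eq_bigr do rewrite -Tx -row_kernel_sum.
rewrite [X in _ = _ - X]exchange_big /= -sumrB; apply: eq_bigr => j _.
rewrite [X in _ = _ - X]exchange_big /= -sumrB; apply: eq_bigr => k _.
by rewrite linearBr /= linear_sumr.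
Qed.

End RowIsometryKernel.

(** * The extension theorem *)

Theorem theorem3p1 (R : realType) (d N : nat) (hd : (1 <= d)%N) (hN : (1 <= N)%N)
    (H : hilbertType R) (K : kernel d H)
    (Kop : operator_valued (Lambda d N) K)
    (Kpd : positive_definite (Lambda d N) K)
    (Kle : kernel_le (Lambda d (N - 1)) (shifted K) K) :
  exists Kt : kernel d H,
    [/\ operator_valued setT Kt,
        positive_definite setT Kt,
        (forall a b, Lambda d (N - 1) a -> Lambda d (N - 1) b ->
           Kt a b = K a b),
        kernel_le setT (shifted Kt) Kt
      & exists (KK : hilbertType R) (S : 'I_d -> KK -> KK) (P : KK -> KK)
               (W : H -> KK),
          [/\ row_isometry S,
              orthogonal_projection P,
              bounded_operator W
            & forall a b : word d,
                Kt a b = adjoint W \o word_op S a \o P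
                           \o adjoint (word_op S b) \o W]].
Proof.
have MN : (N - 1 < N)%N by rewrite subn1 prednK.
have [G [L [V [Llin Lcontr Vlin Vinner LV]]]] := finite_model Kop Kpd MN Kle.
have [KK [S [T [J [Sbd Sadj Srow [Jlin Jinner] TJ]]]]] :=
  isometric_dilation Llin Lcontr.
pose W u := J (V [::] u).
have Wlin : linear W by move=> c u v; rewrite /W Vlin Jlin.
have Wbd : norm_bounded W.
  have [c [c0 Kc]] := bounded_operator_norm (Kop [::] [::] (leq0n _) (leq0n _)).
  exists (sqrtC c); split=> [|u]; first by rewrite sqrtC_ge0.
  rewrite -(@ler_pXn2r _ 2) ?nnegrE ?mulr_ge0 ?sqrtC_ge0 // exprMn sqrtCK.
  rewrite -inner_norm Jinner Vinner // -[leLHS]ger0_norm; last first.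
    by rewrite -Vinner // inner_ge0.
  apply: le_trans (inner_CauchySchwarz _ _) _.
  by rewrite expr2 mulrCA ler_wpM2l.
have [Wt WtP] := adjoint_exists Wlin Wbd.
(* Reading the letters of [a] one by one, [T] acts as [L] on the copy of [G]. *)
have TW a u : (size a <= N - 1)%N -> word_adj T a (W u) = J (V a u).
  elim/last_ind: a => [//|a i IH]; rewrite size_rcons => aN.
  by rewrite /word_adj foldl_rcons -/(word_adj T a _) IH ?(ltnW aN) // TJ LV.
exists (row_kernel S W); split.
- by move=> a b _ _; exact: (row_kernel_operator Sbd Sadj Wlin Wbd WtP).
- exact: (row_kernel_positive Sadj WtP).
- move=> a b aN bN; apply/funext => v; apply: inner_extr => u.
  by rewrite (inner_row_kernel Sadj WtP) !TW // Jinner Vinner.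
- exact: (row_kernel_shifted Sadj Srow WtP).
- exists KK, S, id, W; split=> //.
  + exact: (row_isometryP Sbd Sadj Srow).
  + split=> //; last exact: adjointP.
    by apply: norm_bounded_operator => //; exists 1; split=> // x; rewrite mul1r.
  + exact: norm_bounded_operator.
Qed.
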